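(* Let $k\geq 3$ and $\beta\geq 2$ be fixed integers. There exist constants $C=C(k,\beta)>0$, $n_0=n_0(k,\beta)$ and $\delta^*=\delta^*(k,\beta)>0$ such that the following holds for every integer $n\geq n_0$ and every real $\delta$ with $0\leq\delta\leq\delta^*$. If $H$ is a $k$-graph with vertex set $[n]$ satisfying $\mu(H)\leq\beta$ and $$\rho(H)\geq(1-\delta)\,\rho(S_{n,k,\beta}),$$ then there exists a set $W\subseteq[n]$ with $|W|=\beta$ such that every edge of $H$ intersects $W$, and, after relabeling the vertices of $H$ so that $W$ becomes $[\beta]$ (that is, for some permutation $\sigma$ of $[n]$ with $\sigma(W)=[\beta]$, replacing $E(H)$ by $\{\sigma(e):e\in E(H)\}$), we have $$\left|E(H)\,\triangle\, E(S_{n,k,\beta})\right|\leq C\,\delta\, n^{k-1}.$$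
   Context: Write $[n]=\{1,\ldots,n\}$. A $k$-uniform hypergraph ($k$-graph) $H=(V(H),E(H))$ has a vertex set $V(H)$ and an edge set $E(H)$ consisting of $k$-element subsets of $V(H)$. A matching in $H$ is a collection of pairwise disjoint edges, and the matching number $\mu(H)$ is the maximum size of a matching in $H$. For sets $A,B$, $A\triangle B=(A\setminus B)\cup(B\setminus A)$. $S_{n,k,\beta}$ is the $k$-graph on vertex set $[n]$ whose edges are all $k$-subsets $e$ of $[n]$ with $e\cap[\beta]\neq\emptyset$. The adjacency tensor of a $k$-graph $H$ on $[n]$ is $\mathcal{A}(H)=(a_{i_1\cdots i_k})$, indexed by $(i_1,\ldots,i_k)\in[n]^k$, where $a_{i_1\cdots i_k}=\frac{1}{(k-1)!}$ if $\{i_1,\ldots,i_k\}\in E(H)$ and $a_{i_1\cdots i_k}=0$ otherwise. A number $\lambda\in\mathbb{C}$ is an eigenvalue of a tensor $\mathcal{A}=(a_{i_1\cdots i_k})$ of order $k$ and dimension $n$ if there is a nonzero vector $x\in\mathbb{C}^n$ (an eigenvector) with $\sum_{i_2,\ldots,i_k\in[n]}a_{i i_2\cdots i_k}x_{i_2}\cdots x_{i_k}=\lambda x_i^{k-1}$ for every $i\in[n]$. The spectral radius of a tensor is the maximum modulus of its eigenvalues, and $\rho(H)$ denotes the spectral radius of $\mathcal{A}(H)$. *)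

(* Defs.v *)
From mathcomp Require Import classical_sets reals.
From mathcomp Require Import all_boot all_order all_algebra all_fingroup.
From mathcomp Require Import complex.

Set Implicit Arguments.
Unset Strict Implicit.
Unset Printing Implicit Defensive.

Import Order.TTheory GRing.Theory Num.Theory.

Local Open Scope ring_scope.

Record kgraph (k : nat) (V : finType) := KGraph {
  edges : {set {set V}};
  edges_uniform : forall e, e \in edges -> #|e| = k }.

Definition matching (k : nat) (V : finType) (H : kgraph k V)
    (M : {set {set V}}) : bool :=
  (M \subset edges H) && trivIset M.

Definition matching_number (k : nat) (V : finType) (H : kgraph k V) : nat :=
  \max_(M : {set {set V}} | matching H M) #|M|.

Definition symdiff (T : finType) (A B : {set T}) : {set T} :=
  (A :\: B) :|: (B :\: A).

(* 'I_n stands for {1, ..., n}, the ordinal i encoding i + 1. *)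
Definition initial (n b : nat) : {set 'I_n} := [set i : 'I_n | (i < b)%N].

Definition star_edges (n k b : nat) : {set {set 'I_n}} :=
  [set e : {set 'I_n} | (#|e| == k) && (e :&: initial n b != set0)].

Lemma star_edges_uniform (n k b : nat) (e : {set 'I_n}) :
  e \in star_edges n k b -> #|e| = k.
Proof. by rewrite inE => /andP[/eqP]. Qed.

Definition star (n k b : nat) : kgraph k 'I_n :=
  KGraph (@star_edges_uniform n k b).

Definition relabel (V : finType) (s : {perm V}) (E : {set {set V}}) :
    {set {set V}} :=
  [set [set s v | v in e] | e : {set V} in E].

Definition tensor (C : Type) (k n : nat) := k.-tuple 'I_n -> C.

Section Spectrum.
Local Open Scope complex_scope.
Variable R : realType.

(* The tuple t is (i_1, ..., i_k); the sum is over those with i_1 = i. *)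
Definition tensor_eigenvalue (k n : nat) (a : tensor R[i] k n) (l : R[i]) :
    Prop :=
  exists x : 'rV[R[i]]_n, x != 0 /\
    forall i : 'I_n,
      \sum_(t : k.-tuple 'I_n | ohead t == Some i)
         a t * \prod_(j <- behead t) x 0 j
      = l * x 0 i ^+ k.-1.

(* The set of moduli of eigenvalues is finite, so that its supremum is its
   maximum. *)
Definition tensor_spectral_radius (k n : nat) (a : tensor R[i] k n) : R :=
  sup [set r : R | exists l : R[i], tensor_eigenvalue a l /\ `|l| = r%:C]%classic.

Definition adjacency_tensor (k n : nat) (H : kgraph k 'I_n) : tensor R[i] k n :=
  fun t => if [set j in t] \in edges H then ((k.-1)`!%:R)^-1 else 0.

Definition spectral_radius (k n : nat) (H : kgraph k 'I_n) : R :=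
  tensor_spectral_radius (adjacency_tensor H).

End Spectrum.

(* Main.v *)
(** An eigenvector inequality of Collatz-Wielandt type bounds the spectral radius of a
    k-graph by L as soon as some positive weight z satisfies
    [sum_(f : v |: f edge) prod_(u in f) z u <= L * z v ^ (k-1)] at every vertex v.
    For the star with core W, the weight equal to 1 on W and to a suitable t off W
    (t is of order n^(-1/k)) gives equality, with constant lam say, hence
    rho(S) >= lam.  All upper bounds on rho(H) come from perturbing this weight.

    Let W be the set of vertices of H of degree more than a large constant times
    n^(k-2).  As two vertices have codegree at most n^(k-2), matchings can be built
    greedily from W: hence |W| <= beta, and if |W| = beta then every edge meets W.
    If |W| < beta, weight 1 on W, a small constant on the rest of a bounded vertex
    cover, and slightly less than t elsewhere show that rho(H) <= (1 - c) lam.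
    If |W| = beta and eta n^(k-1) edges are missing at some v0 in W, lowering the weight
    of v0 by a multiple of eta, and the weight off W by the factor 1 - eta / (2 beta),
    gives rho(H) <= (1 - c eta) lam, so that eta = O(delta). *)

Require Import Defs.
From mathcomp Require Import classical_sets reals.
From mathcomp Require Import all_boot all_order all_algebra all_fingroup.
From mathcomp Require Import complex.
From mathcomp Require Import ring lra zify.

Set Implicit Arguments.
Unset Strict Implicit.
Unset Printing Implicit Defensive.

Import Order.TTheory GRing.Theory Num.Theory.

Local Open Scope ring_scope.

(** * Sums over finite sets *)

(** Deleting [w] matches the sets through [w] with the sets avoiding it. *)
Lemma big_set_through (I : finType) (A : Type) (idx : A) (op : Monoid.com_law idx)
    (w : I) (Q : pred {set I}) (F : {set I} -> A) :
  \big[op/idx]_(f : {set I} | (w \in f) && Q f) F f =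
  \big[op/idx]_(f : {set I} | (w \notin f) && Q (w |: f)) F (w |: f).
Proof.
rewrite (reindex_onto (fun f : {set I} => w |: f) (fun f => f :\ w)) /=; last first.
  by move=> f /andP[wf _]; rewrite setD1K.
apply: eq_bigl => f; rewrite setU11 /=.
case wf: (w \in f) => /=; last by rewrite setU1K ?wf ?eqxx ?andbT.
apply/negP => /andP[_ /eqP ef]; have := setD11 w (w |: f).
by rewrite ef wf.
Qed.

Section Sums.
Variables (I : finType).

Definition elem_sym (R : comPzSemiRingType) (z : I -> R) (m : nat) : R :=
  \sum_(f : {set I} | #|f| == m) \prod_(v in f) z v.

(* The left-hand side of the eigenvalue equation at [v], see [adjacency_tensor_apply]. *)
Definition link_sum (R : comPzSemiRingType) (E : {set {set I}}) (z : I -> R) (v : I) : R :=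
  \sum_(f : {set I} | (v \notin f) && (v |: f \in E)) \prod_(u in f) z u.

Variables (R : numDomainType) (z : I -> R).
Hypothesis z0 : forall v, 0 <= z v.

Lemma prod_in_ge0 (f : {set I}) : 0 <= \prod_(v in f) z v.
Proof. by apply: prodr_ge0 => v _. Qed.
#[local] Hint Resolve prod_in_ge0 : core.

Lemma elem_sym_ge0 m : 0 <= elem_sym z m.
Proof. by apply: sumr_ge0. Qed.

Lemma sum_through (w : I) (m : nat) (Q : pred {set I}) :
  \sum_(f : {set I} | (w \in f) && ((#|f| == m.+1) && Q f)) \prod_(v in f) z v =
  z w * \sum_(f : {set I} | (w \notin f) && ((#|f| == m) && Q (w |: f)))
           \prod_(v in f) z v.
Proof.
rewrite big_set_through big_distrr /=; apply: eq_big => f; last first.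
  by case/andP=> wf _; rewrite big_setU1.
by case wf: (w \in f); rewrite //= cardsU1 wf.
Qed.

Lemma le_sum_subpred (J : finType) (P Q : pred J) (F : J -> R) :
  (forall j, 0 <= F j) -> (forall j, P j -> Q j) ->
  \sum_(j | P j) F j <= \sum_(j | Q j) F j.
Proof.
move=> F0 PQ; rewrite big_mkcond [leRHS]big_mkcond /=; apply: ler_sum => j _.
case Pj: (P j); first by rewrite PQ.
by case: ifP.
Qed.

(** A union bound: by nonnegativity, counting an index [j] for several [w] only increases the
    right-hand side. *)
Lemma le_sum_cover (J : finType) (T : {set I}) (P : pred J) (Q : I -> pred J)
    (F : J -> R) :
  (forall j, 0 <= F j) -> (forall j, P j -> exists2 w, w \in T & Q w j) ->
  \sum_(j | P j) F j <= \sum_(w in T) \sum_(j | Q w j) F j.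
Proof.
move=> F0 PQ; rewrite (exchange_big_dep predT) //= [leLHS]big_mkcond /=.
apply: ler_sum => j _; case Pj: (P j); last by apply: sumr_ge0.
have [w wT Qw] := PQ j Pj.
rewrite (bigD1 w) /= ?wT ?Qw // lerDl; exact: sumr_ge0.
Qed.

Lemma sum_meeting_le (T : {set I}) (m : nat) (P : pred {set I}) :
  (forall f, P f -> (#|f| == m.+1) && (f :&: T != set0)) ->
  \sum_(f | P f) \prod_(v in f) z v <= (\sum_(w in T) z w) * elem_sym z m.
Proof.
move=> PT; rewrite big_distrl /=.
apply: le_trans; first apply: (@le_sum_cover _ T P
  (fun w f => (w \in f) && ((#|f| == m.+1) && true)) (fun f => \prod_(v in f) z v)) => //.
  move=> f /PT /andP[-> /set0Pn[w]]; rewrite inE => /andP[wf wT].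
  by exists w; rewrite ?wf.
apply: ler_sum => w _; rewrite sum_through ler_wpM2l //.
by apply: le_sum_subpred => // f /and3P[].
Qed.

(** Deleting one vertex of [T] leaves a set that still meets [T], so [sum_meeting_le] applies to
    it. *)
Lemma sum_meeting_twice_le (T : {set I}) (m : nat) (P : pred {set I}) :
  (forall f, P f -> (#|f| == m.+2) && (1 < #|f :&: T|)%N) ->
  \sum_(f | P f) \prod_(v in f) z v <= (\sum_(w in T) z w) ^+ 2 * elem_sym z m.
Proof.
move=> PT; rewrite expr2 -mulrA big_distrl /=.
apply: le_trans; first apply: (@le_sum_cover _ T P
  (fun w f => (w \in f) && ((#|f| == m.+2) && (1 < #|f :&: T|)%N))
  (fun f => \prod_(v in f) z v)) => //.
  move=> f /PT /andP[-> c2]; have /card_gt0P[w] := ltnW c2.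
  by rewrite inE => /andP[wf wT]; exists w; rewrite ?wf.
apply: ler_sum => w wT; rewrite sum_through ler_wpM2l //.
apply: sum_meeting_le => f /and3P[wf -> c2]; apply: contraTneq c2 => fT.
by rewrite setIUl fT setU0 -leqNgt (leq_trans (subset_leq_card (subsetIl _ _))) ?cards1.
Qed.

(** In the expansion of the power, each [m]-set arises from [m!] ordered choices; the induction
    splits off the first choice. *)
Lemma fact_elem_sym_le (m : nat) : (m`!)%:R * elem_sym z m <= (\sum_v z v) ^+ m.
Proof.
elim: m => [|m IH].
  rewrite fact0 mul1r expr0 /elem_sym (big_pred1 set0) ?big_set0 // => f.
  by rewrite cards_eq0.
have Z0 : 0 <= \sum_v z v by apply: sumr_ge0.
rewrite exprS; apply: le_trans (ler_wpM2l Z0 IH).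
rewrite factS natrM -mulrA mulrCA [leRHS]mulrCA ler_wpM2l ?ler0n //.
(* Double counting: a set of size [m + 1] occurs once for each of its vertices [w]. *)
have -> : m.+1%:R * elem_sym z m.+1 =
    \sum_(w : I) \sum_(f : {set I} | (w \in f) && ((#|f| == m.+1) && true))
       \prod_(v in f) z v.
  rewrite (exchange_big_dep (fun f : {set I} => #|f| == m.+1)) /=; last first.
    by move=> w f _; rewrite andbT => /andP[].
  rewrite /elem_sym big_distrr /=; apply: eq_bigr => f cf.
  rewrite sumr_const -(eqP cf) mulr_natl; congr (_ *+ _).
  by apply: eq_card => w; rewrite [RHS]unfold_in eqxx !andbT.
rewrite big_distrl /=; apply: ler_sum => w _; rewrite sum_through ler_wpM2l //.
by apply: le_sum_subpred => // f /and3P[].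
Qed.

End Sums.

(** * Bounds on the spectral radius *)

Lemma tuple_spanningE (T : finType) (m : nat) (f : {set T}) (t : m.-tuple T) :
  #|f| = m -> ([set j in t] == f) = all (mem f) t && uniq t.
Proof.
move=> cf; apply/eqP/andP => [tf|[/allP tf ut]].
  split; first by apply/allP => j jt /=; rewrite -tf inE.
  by apply/card_uniqP; rewrite size_tuple -[RHS]cf -tf cardsE.
apply/eqP; rewrite eqEcard cf cardsE (card_uniqP ut) size_tuple leqnn andbT.
by apply/subsetP => j; rewrite inE => /tf.
Qed.

Lemma card_tuple_spanning (T : finType) (m : nat) (f : {set T}) :
  #|f| = m -> #|[set t : m.-tuple T | [set j in t] == f]| = m`!.
Proof.
move=> cf; have := card_uniq_tuples m (mem f).
rewrite [X in X ^_ _]cf ffactnn => <-.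
by apply: eq_card => t; rewrite !inE tuple_spanningE.
Qed.

Section Spectral.
Local Open Scope complex_scope.
Variables (R : realType) (m n : nat) (H : kgraph m.+1 'I_n).

(** Each link set is spanned by exactly [m!] tuples, which cancels the entry [1 / m!] of the
    tensor. *)
Lemma adjacency_tensor_apply (x : 'I_n -> R[i]) (i : 'I_n) :
  \sum_(t : m.+1.-tuple 'I_n | ohead t == Some i)
     adjacency_tensor R H t * \prod_(j <- behead t) x j
  = link_sum (edges H) x i.
Proof.
rewrite (reindex_onto (fun t : m.-tuple 'I_n => [tuple of i :: t])
  (fun t => [tuple of behead t])) /=; last first.
  move=> t; case/tupleP: t => j t /= /eqP[->].
  by apply: val_inj.
rewrite (eq_bigl predT); last first.
  by move=> t; rewrite eqxx; apply/eqP/val_inj.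
rewrite /adjacency_tensor /=.
have setE (t : m.-tuple 'I_n) : [set j in i :: t] = i |: [set j in t].
  by apply/setP => j; rewrite !inE.
rewrite (eq_bigr (fun t : m.-tuple 'I_n => if i |: [set j in t] \in edges H
  then (m`!%:R)^-1 * \prod_(j <- t) x j else 0)); last first.
  by move=> t _; rewrite setE; case: ifP => _ //; rewrite mul0r.
rewrite -big_mkcond /= /link_sum.
(* A tuple with a repeated entry, or containing [i], spans together with [i] fewer than [m + 1]
   vertices, hence no edge. *)
have edge_link (f : {set 'I_n}) : (#|f| <= m)%N -> i |: f \in edges H ->
    (i \notin f) && (#|f| == m).
  move=> fm /edges_uniform; rewrite cardsU1; case: (i \in f) => /=.
    by rewrite add0n => fE; rewrite fE ltnn in fm.
  by rewrite add1n => -[->].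
rewrite (partition_big (fun t : m.-tuple 'I_n => [set j in t])
   (fun f : {set 'I_n} => (i \notin f) && (i |: f \in edges H))) /=; last first.
  move=> t tE; rewrite tE andbT.
  have tm : (#|[set j in t]| <= m)%N.
    by rewrite cardsE (leq_trans (card_size _)) ?size_tuple.
  by case/andP: (edge_link _ tm tE).
apply: eq_bigr => f /andP[jf fE].
have cf : #|f| = m.
  by move/edges_uniform: fE; rewrite cardsU1 jf => -[].
rewrite (eq_bigl (mem [set t : m.-tuple 'I_n | [set j in t] == f])); last first.
  move=> t; rewrite [RHS]inE; case: eqP => [->|]; last by rewrite andbF.
  by rewrite fE.
rewrite (eq_bigr (fun=> (m`!%:R)^-1 * \prod_(u in f) x u)).
  rewrite sumr_const card_tuple_spanning // -[LHS]mulr_natl mulrA divff ?mul1r //.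
  by rewrite pnatr_eq0 -lt0n fact_gt0.
move=> t; rewrite [X in X -> _]/= inE => tf; have [_ ut] : all (mem f) t /\ uniq t.
  by apply/andP; rewrite -tuple_spanningE.
congr (_ * _); rewrite -(eqP tf) big_uniq //=.
by apply: eq_bigl => j; rewrite inE.
Qed.

(** By the triangle inequality, the moduli [y] of an eigenvector satisfy
    [r * y v ^ m <= link_sum (edges H) y v]. At a vertex [i] maximizing [y / z], with maximum [c],
    one has [y <= c * z] everywhere with equality at [i], and the [m]-homogeneity of the link sum
    gives [r <= L]. *)
Lemma eigenvalue_le (z : 'I_n -> R) (L r : R) (l : R[i]) :
  (forall v, 0 < z v) ->
  (forall v, link_sum (edges H) z v <= L * z v ^+ m) ->
  tensor_eigenvalue (adjacency_tensor R H) l -> `|l| = r%:C -> r <= L.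
Proof.
move=> z0 zL [x [x0 xE]] lr.
pose y v := complex.Re `|x 0 v|.
have yE v : `|x 0 v| = (y v)%:C by rewrite /y normc_def.
have y0 v : 0 <= y v by rewrite -lecR -yE normr_ge0.
have rE v : r * y v ^+ m <= link_sum (edges H) y v.
  rewrite -lecR rmorphM rmorphXn /= -yE -lr -normrX -normrM.
  rewrite -(xE v) (adjacency_tensor_apply (fun j => x 0 j)) /link_sum.
  rewrite rmorph_sum; apply: le_trans (ler_norm_sum _ _ _) _.
  apply: ler_sum => f _; rewrite normr_prod rmorph_prod.
  by under eq_bigr do rewrite yE.
have [v0 v0P] : exists v, y v != 0.
  apply/existsP; apply: contraNT x0; rewrite negb_exists => /forallP xy.
  apply/eqP/rowP => v; rewrite mxE; apply/eqP; rewrite -normr_eq0 yE.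
  by have := xy v; rewrite negbK => /eqP ->.
have [i _ iP] := @arg_maxP _ R 'I_n v0 predT (fun v => y v / z v) isT.
set c := y i / z i in iP.
have c0 : 0 < c.
  apply: lt_le_trans (iP v0 isT); rewrite divr_gt0 //.
  by rewrite lt_def v0P y0.
have yc v : y v <= c * z v by rewrite -ler_pdivrMr //; apply: iP.
have yi : y i = c * z i by rewrite /c divfK // gt_eqF.
clearbody c.
have H1 : r * (c * z i) ^+ m <= c ^+ m * (L * z i ^+ m).
  rewrite -yi; apply: le_trans (rE i) _.
  apply: (@le_trans _ _ (c ^+ m * link_sum (edges H) z i)); last first.
    by rewrite ler_wpM2l ?exprn_ge0 // ltW.
  rewrite /link_sum big_distrr /=; apply: ler_sum => f /andP[jf fE].
  have cf : #|f| = m by move/edges_uniform: fE; rewrite cardsU1 jf => -[].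
  rewrite -{1}cf -prodr_const -big_split /=; apply: ler_prod => u _.
  by rewrite y0 yc.
have zc : 0 < (c * z i) ^+ m by apply: exprn_gt0; apply: mulr_gt0.
by rewrite -(ler_pM2r zc) (le_trans H1) // exprMn mulrCA.
Qed.

Lemma spectral_radius_le (z : 'I_n -> R) (L : R) :
  0 <= L -> (forall v, 0 < z v) ->
  (forall v, link_sum (edges H) z v <= L * z v ^+ m) ->
  spectral_radius R H <= L.
Proof.
move=> L0 z0 zL; rewrite /spectral_radius /tensor_spectral_radius.
set E := [set r | _]%classic.
(* Without eigenvalues the supremum takes the default value 0; here [0 <= L] is used. *)
have [->|/set0P E0] := eqVneq E classical_sets.set0; first by rewrite sup0.
by apply: ge_sup => // r [l [lE lr]]; apply: eigenvalue_le lE lr.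
Qed.

(** [z] is itself an eigenvector, nonzero because [0 < n]; [eigenvalue_le] shows that the set of
    moduli is bounded, so that its supremum is meaningful. *)
Lemma spectral_radius_ge (z : 'I_n -> R) (L : R) :
  (0 < n)%N -> 0 <= L -> (forall v, 0 < z v) ->
  (forall v, link_sum (edges H) z v = L * z v ^+ m) ->
  L <= spectral_radius R H.
Proof.
move=> n0 L0 z0 zL; apply: ub_le_sup.
  by exists L => r [l [lE lr]]; apply: eigenvalue_le lE lr => // v; rewrite zL.
exists L%:C; split; last by rewrite ger0_norm // lecR.
exists (\row_v (z v)%:C); split.
  apply/eqP => /rowP /(_ (Ordinal n0)); rewrite !mxE => /complexI z00.
  by have := z0 (Ordinal n0); rewrite z00 ltxx.
move=> v; have E := adjacency_tensor_apply (fun u => (z u)%:C) v; rewrite mxE.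
transitivity ((link_sum (edges H) z v)%:C).
  rewrite rmorph_sum /=.
  under eq_bigr do under eq_bigr do rewrite mxE.
  by rewrite E; apply: eq_bigr => f _; rewrite rmorph_prod.
by rewrite zL rmorphM rmorphXn.
Qed.

End Spectral.

(** * Greedy matchings *)

Lemma disjoint_setUr (T : finType) (A B C : {set T}) :
  [disjoint A & B :|: C] = [disjoint A & B] && [disjoint A & C].
Proof. by rewrite -!setI_eq0 setIUr setU_eq0. Qed.

Section Matchings.
Variables (k : nat) (V : finType) (H : kgraph k V).

Definition degree (v : V) : nat := #|[set e in edges H | v \in e]|.

Lemma matching_le (M : {set {set V}}) :
  matching H M -> (#|M| <= matching_number H)%N.
Proof. by move=> MH; rewrite /matching_number (bigD1 M) //= leq_maxl. Qed.

Lemma matchingU1 (e : {set V}) (M : {set {set V}}) :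
  e \in edges H -> e != set0 -> matching H M ->
  (forall f, f \in M -> [disjoint e & f]) ->
  matching H (e |: M) /\ #|e |: M| = #|M|.+1.
Proof.
move=> eH e0 /andP[MH tM] eM.
have eNM : e \notin M.
  by apply: contra e0 => /eM; rewrite -setI_eq0 setIid.
split; last by rewrite cardsU1 eNM.
rewrite /matching subUset sub1set eH MH /=.
(* [trivIsetU1] applies when [M] lacks the empty set; otherwise pairs are compared directly. *)
have sM : set0 \notin M -> trivIset (e |: M).
  by move=> M0; case: (trivIsetU1 eM tM M0).
case M0: (set0 \in M); last by apply: sM; rewrite M0.
apply/trivIsetP => A B; rewrite !inE => /orP[/eqP->|AM] /orP[/eqP->|BM] AB.
- by rewrite eqxx in AB.
- exact: eM.
- by rewrite disjoint_sym eM.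
- by move/trivIsetP: tM; apply.
Qed.

(** The vertices of a maximum matching meet every edge, since a disjoint edge would extend it. *)
Lemma matching_cover : (0 < k)%N ->
  exists T : {set V}, (#|T| <= k * matching_number H)%N /\
    forall e, e \in edges H -> e :&: T != set0.
Proof.
move=> k0.
have MH0 : matching H set0.
  by rewrite /matching sub0set; apply/trivIsetP => A; rewrite inE.
pose M := [arg max_(M > set0 | matching H M) #|M|].
have [MH Mmax] : matching H M /\ forall M', matching H M' -> (#|M'| <= #|M|)%N.
  by rewrite /M; case: arg_maxnP.
exists (cover M); split.
  rewrite (leq_trans (leq_card_cover M)) //.
  rewrite (eq_bigr (fun=> k)); last first.
    by case/andP: MH => /subsetP MH _ e /MH /edges_uniform.
  by rewrite sum_nat_const mulnC leq_mul2l matching_le ?orbT.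
move=> e eH; apply/negP => /eqP eT.
have e0 : e != set0 by rewrite -card_gt0 (edges_uniform eH).
have [|MH' cM'] := matchingU1 eH e0 MH.
  move=> f fM; rewrite -setI_eq0 -subset0 -eT setIS //.
  exact: bigcup_sup.
by have := Mmax _ MH'; rewrite cM' ltnn.
Qed.

Variables (N : nat).
Hypothesis codegree_le : forall a b : V, a != b ->
  (#|[set e in edges H | (a \in e) && (b \in e)]| <= N)%N.

(** Each vertex of [F] spoils at most [N] of the edges through [a]. *)
Lemma exists_edge_avoiding (a : V) (F : {set V}) :
  a \notin F -> (#|F| * N < degree a)%N ->
  exists e, [/\ e \in edges H, a \in e & [disjoint e & F]].
Proof.
move=> aF deg.
case: (pickP [pred e | [&& e \in edges H, a \in e & [disjoint e & F]]]) => /= [e|noe].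
  by case/and3P=> eH ae eF; exists e.
move: deg; rewrite ltnNge => /negP[]; rewrite /degree.
have sub : [set e in edges H | a \in e] \subset
    \bigcup_(b in F) [set e in edges H | (a \in e) && (b \in e)].
  apply/subsetP => e; rewrite inE => /andP[eH ae].
  have : ~~ [disjoint e & F] by have /= := noe e; rewrite eH ae /= => ->.
  rewrite -setI_eq0 => /set0Pn[b]; rewrite inE => /andP[be bF].
  by apply/bigcupP; exists b; rewrite // inE eH ae.
apply: leq_trans (subset_leq_card sub) _.
apply: (@leq_trans (\sum_(b in F) N)); last by rewrite sum_nat_const.
rewrite -sum1_card.
apply: (@leq_trans (\sum_(b in F) #|[set e in edges H | (a \in e) && (b \in e)]|)).
  rewrite sum1_card; elim/big_rec2: _ => [|b m B bF IH]; first by rewrite cards0.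
  by rewrite (leq_trans (leq_card_setU _ _)) // leq_add2l.
apply: leq_sum => b bF; apply: codegree_le.
by apply: contraNneq aF => ->.
Qed.

(** Choose an edge through some [a] in [A] avoiding [F] and the rest of [A], and move it into [F].
    As [A] loses a vertex and [F] gains at most [k], the quantity [#|F| + k * #|A|] does not grow,
    and it bounds the number of vertices to be avoided at each step. *)
Lemma greedy_matching (c : nat) (A F : {set V}) :
  [disjoint A & F] -> (#|F| + k * #|A| <= c)%N ->
  (forall a, a \in A -> (c * N < degree a)%N) -> (0 < k)%N ->
  exists M, [/\ matching H M, #|M| = #|A| & forall e, e \in M -> [disjoint e & F]].
Proof.
move=> + + + k0; move cA : #|A| => r.
elim: r A F cA => [|r IH] A F cA dAF cF deg.
  exists set0; split; [|by rewrite cards0|by move=> e; rewrite inE].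
  by rewrite /matching sub0set; apply/trivIsetP => B; rewrite inE.
have [a aA] : exists a, a \in A by apply/card_gt0P; rewrite cA.
have cAa : #|A :\ a| = r by apply/eqP; rewrite -eqSS -cA (cardsD1 a A) aA.
have [||e [eH ae eFA]] := @exists_edge_avoiding a (F :|: (A :\ a)).
- by rewrite !inE eqxx orbF (disjointFr dAF aA).
- apply: leq_ltn_trans (deg a aA); rewrite leq_mul2r.
  rewrite (leq_trans (leq_card_setU _ _)) ?orbT // cAa.
  rewrite (leq_trans _ cF) // leq_add2l mulnS.
  by rewrite (leq_trans _ (leq_addl _ _)) // leq_pmull.
have ce := edges_uniform eH.
move: eFA; rewrite disjoint_setUr => /andP[Fe Ae].
have [||a' a'A|M [MH cM MF]] := IH (A :\ a) (F :|: e) cAa.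
- rewrite disjoint_setUr [X in _ && X]disjoint_sym Ae andbT.
  by rewrite (disjointWl _ dAF) // subD1set.
- apply: leq_trans cF; rewrite mulnS addnA leq_add2r.
  by rewrite (leq_trans (leq_card_setU _ _)) // ce.
- by apply: deg; case/setD1P: a'A.
have [||MH' cM'] := matchingU1 eH _ MH.
- by apply/set0Pn; exists a.
- by move=> f /MF; rewrite disjoint_setUr => /andP[_]; rewrite disjoint_sym.
exists (e |: M); split=> //; first by rewrite cM' cM.
move=> f; rewrite !inE => /orP[/eqP->//|/MF].
by rewrite disjoint_setUr => /andP[].
Qed.

Definition heavy (c : nat) : {set V} := [set v | (c * N < degree v)%N].

(** Otherwise [b + 1] heavy vertices would carry a matching of size [b + 1]; the threshold is
    [k * #|A|] for such a set [A]. *)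
Lemma card_heavy_le (b : nat) : (0 < k)%N ->
  (matching_number H <= b)%N -> (#|heavy (k * b.+1)| <= b)%N.
Proof.
move=> k0 Hb; rewrite leqNgt; apply/negP => cW.
have [A /andP[AW /eqP cA]] : exists A : {set V},
    (A \subset heavy (k * b.+1)) && (#|A| == b.+1).
  have : (0 < #|[set A : {set V} | A \subset heavy (k * b.+1) & #|A| == b.+1]|)%N.
    by rewrite cards_draws bin_gt0.
  by case/card_gt0P => A; rewrite inE => ?; exists A.
have [||a aA||M [MH cM _]] := @greedy_matching (k * b.+1) A set0.
- by rewrite -setI_eq0 setI0.
- by rewrite cards0 cA.
- by move/subsetP: AW => /(_ a aA); rewrite inE.
- by [].
by have := leq_trans (matching_le MH) Hb; rewrite cM cA ltnn.
Qed.

(** An edge [e] missing the heavy set would extend a matching of size [b] found greedily outside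
    [e]; the vertices to avoid number at most [k + k * b], which is the threshold again. *)
Lemma heavy_meets (b : nat) (e : {set V}) : (0 < k)%N ->
  (matching_number H <= b)%N -> #|heavy (k * b.+1)| = b ->
  e \in edges H -> e :&: heavy (k * b.+1) != set0.
Proof.
move=> k0 Hb cW eH; apply/negP => eW.
have e0 : e != set0 by rewrite -card_gt0 (edges_uniform eH).
have [||a aA||M [MH cM Me]] := @greedy_matching (k * b.+1) (heavy (k * b.+1)) e.
- by rewrite disjoint_sym -setI_eq0.
- by rewrite cW (edges_uniform eH) mulnS.
- by rewrite inE in aA.
- by [].
have [|MH' cM'] := matchingU1 eH e0 MH.
  by move=> f /Me; rewrite disjoint_sym.
by have := leq_trans (matching_le MH') Hb; rewrite cM' cM cW ltnn.
Qed.

End Matchings.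

(** Deleting [a] and [b] embeds these edges into the [m]-sets. *)
Lemma codegree_le_expn (V : finType) (m : nat) (H : kgraph m.+2 V) (a b : V) :
  a != b ->
  (#|[set e in edges H | (a \in e) && (b \in e)]| <= #|V| ^ m)%N.
Proof.
move=> ab; set S := [set _ in _ | _].
have inj : {in S &, injective (fun e : {set V} => e :\ a :\ b)}.
  move=> e f; rewrite !inE => /and3P[_ ae be] /and3P[_ af bf] ef.
  have ba : b != a by rewrite eq_sym.
  rewrite -(setD1K ae) -(setD1K af); congr (_ |: _).
  have be' : b \in e :\ a by rewrite !inE ba.
  have bf' : b \in f :\ a by rewrite !inE ba.
  by rewrite -(setD1K be') ef setD1K.
rewrite -(card_in_imset inj).
apply: (@leq_trans #|[set f : {set V} | #|f| == m]|).
  apply/subset_leq_card/subsetP => _ /imsetP[e + ->]; rewrite !inE.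
  move=> /and3P[/edges_uniform ce ae be].
  have : #|e :\ a| = m.+1 by move: ce; rewrite (cardsD1 a) ae => -[].
  by rewrite (cardsD1 b) !inE be eq_sym ab => -[] /eqP.
rewrite card_draws -(leq_pmul2r (fact_gt0 m)) bin_ffact.
apply: (@leq_trans (#|V| ^ m)); last by rewrite leq_pmulr ?fact_gt0.
elim: m {H S inj} => // m IH; rewrite ffactnSr expnSr.
by rewrite leq_mul // leq_subr.
Qed.

(** * Stars *)

Lemma exists_perm_nth (T : finType) (s1 s2 : seq T) :
  uniq s1 -> uniq s2 -> size s1 = #|T| -> size s2 = #|T| ->
  exists s : {perm T}, map s s1 = s2.
Proof.
move=> u1 u2 c1 c2; case: s1 u1 c1 => [|x0 s1'] u1 c1.
  by exists 1%g; case: s2 u2 c2 => //= x s _; rewrite -c1.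
set s1 := x0 :: s1' in u1 c1 *.
have mem1 x : x \in s1.
  by rewrite ((subset_cardP _ (subset_predT _)) x) // (card_uniqP u1).
pose f x := nth x0 s2 (index x s1).
have f_inj : injective f.
  move=> x y /eqP; rewrite /f nth_uniq ?c2 -?c1 ?index_mem // => /eqP.
  exact: index_inj.
exists (perm f_inj); apply: (@eq_from_nth _ x0); rewrite size_map c1 ?c2 // => i iT.
by rewrite (nth_map x0) ?c1 // permE /f index_uniq ?c1.
Qed.

Lemma exists_perm_set (T : finType) (A B : {set T}) (a b : T) :
  #|A| = #|B| -> (a \in A) = (b \in B) ->
  exists s : {perm T}, [set s v | v in A] = B /\ s a = b.
Proof.
(* The list starts with [a], continues with the rest of whichever of [A] and its complement contains
   [a], and ends with the other one. Matching two such lists entry by entry respects both the set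
   and the point. *)
pose enu (A : {set T}) a := if a \in A then a :: enum (A :\ a) ++ enum (~: A)
  else a :: enum (~: A :\ a) ++ enum A.
have enuU C c : uniq (enu C c).
  rewrite /enu; case: ifP => cC /=.
    rewrite mem_cat !mem_enum !inE eqxx cC /= cat_uniq !enum_uniq /= andbT.
    apply/hasPn => x; rewrite !mem_enum !inE => /negbTE->.
    by rewrite andbF.
  rewrite mem_cat !mem_enum !inE eqxx cC /= cat_uniq !enum_uniq /= andbT.
  by apply/hasPn => x; rewrite !mem_enum !inE => ->; rewrite andbF.
have enuS C c : size (enu C c) = #|T|.
  rewrite /enu; case: ifP => cC /=; rewrite size_cat -!cardE.
    by rewrite -addSn -(cardsC C) (cardsD1 c C) cC.
  by rewrite -addSn addnC -(cardsC C) (cardsD1 c (~: C)) inE cC.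
move=> cAB ab.
have [s sE] := exists_perm_nth (enuU A a) (enuU B b) (enuS A a) (enuS B b).
exists s; rewrite /enu ab in sE; move: sE; case: ifP => bB /=;
  rewrite map_cat => -[sab /eqP]; rewrite eqseq_cat ?size_map -?cardE;
  [|by have := cAB; rewrite (cardsD1 a A) (cardsD1 b B) ab bB => -[]|
  |by have := cardsC A; rewrite -(cardsC B) cAB => /addnI;
      rewrite (cardsD1 a (~: A)) (cardsD1 b (~: B)) !inE ab bB => -[]].
- case/andP => /eqP s1 _; split=> //.
  rewrite -(@setD1K _ a A) ?ab // imsetU1 sab -(@setD1K _ b B) //; congr (_ |: _).
  by apply/setP => x; rewrite -[RHS]mem_enum -s1; apply/imsetP/mapP => -[y];
     rewrite ?mem_enum => yA ->; exists y; rewrite ?mem_enum.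
- case/andP => _ /eqP s1; split=> //.
  by apply/setP => x; rewrite -[RHS]mem_enum -s1; apply/imsetP/mapP => -[y];
     rewrite ?mem_enum => yA ->; exists y; rewrite ?mem_enum.
Qed.

(** The values lie in any semiring, so that [t] may also be the indeterminate of a polynomial
    ring. *)
Definition core_weight (R : pzSemiRingType) (V : finType) (W : {set V}) (t : R)
    (v : V) : R :=
  if v \in W then 1 else t.

(** The core is arbitrary, because the heavy set of [H] need not be an initial segment;
    [star_edges n k b] is the case [W = initial n b]. *)
Definition star_on (V : finType) (k : nat) (W : {set V}) : {set {set V}} :=
  [set e : {set V} | (#|e| == k) && (e :&: W != set0)].

Section LinkSums.
Variable V : finType.

Lemma link_sum_rmorph (R S : comPzSemiRingType) (phi : {rmorphism R -> S})
    (E : {set {set V}}) (z : V -> R) (v : V) :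
  link_sum E (fun u => phi (z u)) v = phi (link_sum E z v).
Proof.
by rewrite rmorph_sum; apply: eq_bigr => f _; rewrite rmorph_prod.
Qed.

Lemma eq_link_sum (R : comPzSemiRingType) (E : {set {set V}}) (z z' : V -> R) v :
  z =1 z' -> link_sum E z v = link_sum E z' v.
Proof. by move=> zz; apply: eq_bigr => f _; apply: eq_bigr => u _. Qed.

Lemma link_sum_perm (R : comPzSemiRingType) (E E' : {set {set V}}) (z : V -> R)
    (v : V) (s : {perm V}) :
  (forall e : {set V}, ([set s x | x in e] \in E') = (e \in E)) ->
  link_sum E' z (s v) = link_sum E (fun u => z (s u)) v.
Proof.
move=> EE; rewrite /link_sum.
rewrite (reindex_inj (imset_inj (@perm_inj _ s))) /=; apply: eq_big => f.
  by rewrite -imsetU1 EE mem_imset //; apply: perm_inj.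
by move=> _; rewrite big_imset //= => x y _ _; apply: perm_inj.
Qed.

Lemma mem_star_on_perm (k : nat) (W e : {set V}) (s : {perm V}) :
  ([set s x | x in e] \in star_on k [set s x | x in W]) = (e \in star_on k W).
Proof.
rewrite !inE card_imset; last exact: perm_inj.
rewrite -imsetI; last by move=> x y _ _; apply: perm_inj.
by rewrite -!card_gt0 card_imset //; apply: perm_inj.
Qed.

(** By symmetry the link sum depends only on the size of the core and on whether the vertex lies in
    it. One eigenpair thus serves for all cores of a given size. *)
Lemma link_sum_star_perm (R : comPzSemiRingType) (k : nat) (W W' : {set V})
    (t : R) (v v' : V) :
  #|W| = #|W'| -> (v \in W) = (v' \in W') ->
  link_sum (star_on k W) (core_weight W t) v =
  link_sum (star_on k W') (core_weight W' t) v'.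
Proof.
move=> cW vW; have [s [sW <-]] := exists_perm_set cW vW.
rewrite (@link_sum_perm _ (star_on k W)); first apply: eq_link_sum => u.
  by rewrite /core_weight -sW mem_imset //; apply: perm_inj.
by move=> e; rewrite -sW mem_star_on_perm.
Qed.

Lemma star_link_in (k : nat) (W : {set V}) (v : V) (f : {set V}) : v \in W ->
  ((v \notin f) && (v |: f \in star_on k.+1 W)) = (v \notin f) && (#|f| == k).
Proof.
move=> vW; rewrite inE cardsU1; case: (v \notin f) => //=.
rewrite add1n eqSS andbC; case: eqP => // /setP/(_ v).
by rewrite !inE eqxx vW.
Qed.

Lemma star_link_out (k : nat) (W : {set V}) (v : V) (f : {set V}) : v \notin W ->
  ((v \notin f) && (v |: f \in star_on k.+1 W)) =
  [&& v \notin f, #|f| == k & f :&: W != set0].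
Proof.
move=> vW; rewrite inE cardsU1; case: (v \notin f) => //=.
rewrite add1n eqSS setIUl; congr (_ && (_ != set0)).
suff -> : [set v] :&: W = set0 by rewrite set0U.
by apply/eqP; rewrite setI_eq0 disjoints1.
Qed.

Lemma sum_draws_const (R : comPzSemiRingType) (B : {set V}) (m : nat) (z : V -> R) (t : R) :
  (forall v, v \in B -> z v = t) ->
  \sum_(f : {set V} | (f \subset B) && (#|f| == m)) \prod_(v in f) z v =
  t ^+ m *+ 'C(#|B|, m).
Proof.
move=> zB; rewrite -cards_draws -sumr_const.
apply: eq_big => [f|f /andP[/subsetP fB /eqP <-]]; first by rewrite inE.
by rewrite -prodr_const; apply: eq_bigr => v /fB /zB.
Qed.

(** The link sets are split by whether they have one or several vertices in [W]; in the first case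
    the product factors into a core vertex and an [m]-set off [W]. *)
Lemma link_sum_star_out (R : comPzSemiRingType) (m : nat) (W : {set V}) (z : V -> R) (u : V) :
  u \notin W ->
  link_sum (star_on m.+2 W) z u =
  (\sum_(w in W) z w) *
    \sum_(g : {set V} | (g \subset ~: (u |: W)) && (#|g| == m)) \prod_(v in g) z v
  + \sum_(f : {set V} | [&& u \notin f, #|f| == m.+1 & (1 < #|f :&: W|)%N])
      \prod_(v in f) z v.
Proof.
move=> uW; rewrite /link_sum (eq_bigl _ _ (fun f => star_link_out _ f uW)).
rewrite (bigID (fun f : {set V} => (1 < #|f :&: W|)%N)) /= addrC; congr (_ + _); last first.
  apply: eq_bigl => f; rewrite -card_gt0 -!andbA; do 2!congr (_ && _).
  by case: #|_| => [|[]].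
transitivity (\sum_(w in W) \sum_(f : {set V} | (w \in f) &&
    [&& u \notin f, #|f| == m.+1 & f :&: W == [set w]]) \prod_(v in f) z v).
  rewrite (exchange_big_dep (fun f : {set V} =>
     [&& u \notin f, #|f| == m.+1 & (f :&: W != set0)] && ~~ (1 < #|f :&: W|)%N)) /=.
    apply: eq_bigr => f /andP[/and3P[uf cf f0] f1].
    have /cards1P[w fw] : #|f :&: W| == 1%N.
      by rewrite eqn_leq card_gt0 f0 leqNgt f1.
    have /setIP[wf wW] : w \in f :&: W by rewrite fw set11.
    rewrite [RHS](big_pred1 w) // => x; rewrite uf cf fw /= (inj_eq set1_inj).
    by rewrite eq_sym; case: eqP => [->|]; rewrite ?wf ?wW ?andbF.
  move=> w f wW /and4P[wf -> -> /eqP ->].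
  by rewrite cards1 -card_gt0 cards1.
rewrite big_distrl /=; apply: eq_bigr => w wW.
rewrite big_set_through big_distrr /=; apply: eq_big => [f|f]; last first.
  by case/andP=> wf _; rewrite big_setU1.
have uw : u != w by apply: contraNneq uW => ->.
rewrite -disjoints_subset disjoint_setUr disjoint_sym disjoints1 -setI_eq0.
rewrite !inE (negbTE uw) /= cardsU1.
case wf: (w \in f) => /=.
  apply/esym/negbTE; rewrite negb_and negb_and; apply/orP; left; apply/orP; right.
  by apply/set0Pn; exists w; rewrite inE wf.
rewrite add1n eqSS andbAC -andbA; congr (_ && _); congr (_ && _).
rewrite setIUl (setIidPl _) ?sub1set //.
apply/eqP/eqP => [/setP fW|->]; last by rewrite setU0.
apply/setP => x; have := fW x; rewrite !inE; case: eqP => [->|] //=.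
by rewrite wf.
Qed.

End LinkSums.

(** * Size estimates and an explicit eigenpair for stars *)

Lemma leq_expn_bin (N m : nat) : ((N - m) ^ m <= 'C(N, m) * m`!)%N.
Proof.
rewrite bin_ffact; elim: m => // m IH.
rewrite ffactnSr expnSr leq_mul ?leq_sub2l // (leq_trans _ IH) //.
by case: m {IH} => // m; rewrite leq_exp2r // leq_sub2l.
Qed.

Lemma bin_ge (R : realType) (N m : nat) (x : R) :
  0 <= x -> x <= (N - m)%:R -> x ^+ m <= 'C(N, m)%:R * m`!%:R.
Proof.
move=> x0 xN; rewrite -natrM; apply: (@le_trans _ _ ((N - m)%:R ^+ m)).
  by rewrite lerXn2r ?nnegrE.
by rewrite -natrX ler_nat leq_expn_bin.
Qed.

Section StarEstimates.
Variables (R : realType) (V : finType) (W : {set V}) (t : R).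
Hypothesis t0 : 0 <= t.
Let z := core_weight W t.

Lemma core_weight_ge0 v : 0 <= z v.
Proof. by rewrite /z /core_weight; case: ifP. Qed.

Lemma sum_core_weight_le : \sum_v z v <= #|W|%:R + t * #|V|%:R.
Proof.
rewrite (bigID (mem W)) /= lerD //.
  rewrite (eq_bigr (fun=> 1)) ?sumr_const // => v vW.
  by rewrite /z /core_weight vW.
rewrite (eq_bigr (fun=> t)); last by move=> v /negbTE vW; rewrite /z /core_weight vW.
by rewrite sumr_const -[leLHS]mulr_natr ler_wpM2l // ler_nat max_card.
Qed.

Lemma elem_sym_core_le m :
  m`!%:R * elem_sym z m <= (#|W|%:R + t * #|V|%:R) ^+ m.
Proof.
apply: le_trans (fact_elem_sym_le core_weight_ge0 m) _.
rewrite lerXn2r ?nnegrE ?sum_core_weight_le //.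
  by apply: sumr_ge0 => v _; apply: core_weight_ge0.
by rewrite addr_ge0 ?mulr_ge0.
Qed.

(** Only the link sets disjoint from [W] are kept. *)
Lemma link_star_in_ge m v : v \in W ->
  t ^+ m *+ 'C(#|V| - #|W|, m) <= link_sum (star_on m.+1 W) z v.
Proof.
move=> vW; rewrite /link_sum (eq_bigl _ _ (fun f => star_link_in _ f vW)).
rewrite -[X in 'C(X - _, _)](cardsC W) addKn.
rewrite -(@sum_draws_const _ _ (~: W) m z); last first.
  by move=> u; rewrite inE => /negbTE uW; rewrite /z /core_weight uW.
apply: (le_sum_subpred (prod_in_ge0 core_weight_ge0)) => f /andP[fW ->].
by rewrite andbT; apply: contraL vW => /(subsetP fW); rewrite inE.
Qed.

Lemma link_star_in_le m v : v \in W ->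
  link_sum (star_on m.+1 W) z v <= elem_sym z m.
Proof.
move=> vW; rewrite /link_sum (eq_bigl _ _ (fun f => star_link_in _ f vW)).
by apply: (le_sum_subpred (prod_in_ge0 core_weight_ge0)) => f /andP[].
Qed.

Lemma sum_core_weight_in : \sum_(w in W) z w = #|W|%:R.
Proof.
rewrite (eq_bigr (fun=> 1)) ?sumr_const // => v vW.
by rewrite /z /core_weight vW.
Qed.

Lemma sum_draws_core u m : u \notin W ->
  \sum_(g : {set V} | (g \subset ~: (u |: W)) && (#|g| == m)) \prod_(v in g) z v =
  t ^+ m *+ 'C(#|V| - #|W|.+1, m).
Proof.
move=> uW; rewrite -[X in 'C(X - _, _)](cardsC (u |: W)) cardsU1 uW add1n addKn.
apply: sum_draws_const => v; rewrite !inE negb_or => /andP[_ /negbTE vW].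
by rewrite /z /core_weight vW.
Qed.

(** Only the link sets with exactly one vertex in [W] are kept. *)
Lemma link_star_out_ge m u : u \notin W ->
  #|W|%:R * (t ^+ m *+ 'C(#|V| - #|W|.+1, m)) <= link_sum (star_on m.+2 W) z u.
Proof.
move=> uW; rewrite link_sum_star_out // sum_core_weight_in sum_draws_core //.
by rewrite lerDl; apply: sumr_ge0 => f _; apply: prod_in_ge0 core_weight_ge0 _.
Qed.

Lemma link_star_out_le m u : u \notin W ->
  link_sum (star_on m.+2 W) z u <= #|W|%:R * elem_sym z m.
Proof.
move=> uW; rewrite /link_sum (eq_bigl _ _ (fun f => star_link_out _ f uW)).
by rewrite -sum_core_weight_in; apply: (sum_meeting_le core_weight_ge0) => f /andP[].
Qed.

End StarEstimates.

Lemma card_initial (n b : nat) : (b <= n)%N -> #|initial n b| = b.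
Proof.
move=> bn; have wi : injective (widen_ord bn) by move=> i j /(congr1 val) /= /val_inj.
rewrite -[RHS]card_ord -(card_imset _ wi).
apply: eq_card => i; rewrite inE; apply/idP/imsetP => [ib|[j _ ->]]; last by rewrite /= ltn_ord.
by exists (Ordinal ib) => //; apply: val_inj.
Qed.

Lemma exists_nat_bound (R : realType) (x : R) :
  exists n0 : nat, forall n, (n0 <= n)%N -> x <= n%:R.
Proof.
exists (Num.bound `|x|) => n n0; apply: le_trans (ler_norm x) _.
by apply: le_trans (ltW (archi_boundP (normr_ge0 x))) _; rewrite ler_nat.
Qed.

(** By symmetry the eigenvalue equations reduce to two, at a core vertex and at a vertex off the
    core, and eliminating [lam] leaves one polynomial equation in [t]. Locating a root between
    [D / n] and [tau] makes [t] as small, and [t * n] as large, as later estimates require. *)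
Lemma star_eigenpair (R : realType) (q b : nat) (tau D : R) :
  (0 < b)%N -> 0 < tau -> tau <= 1 -> 1 <= D ->
  exists n0 : nat, forall n, (n0 <= n)%N -> exists t lam : R,
    [/\ 0 < t, t <= tau, D <= t * n%:R &
     forall (W : {set 'I_n}) v, #|W| = b ->
       link_sum (star_on q.+3 W) (core_weight W t) v = lam * core_weight W t v ^+ q.+2].
Proof.
move=> b0 tau0 tau1 D1.
(* The three thresholds serve for [D / n <= tau], for the sign of [p] at [D / n] and for its sign at
   [tau]. *)
have [n1 n1P] := exists_nat_bound (D / tau).
have [n2 n2P] := exists_nat_bound (2 * (q.+1`!%:R * (b%:R + D) ^+ q.+2)).
have [n3 n3P] := exists_nat_bound
  (2 * (q.+2`!%:R * (2 ^+ q.+1 * b%:R * 2 ^+ q.+1)) / tau ^+ (2 * q.+2)).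
exists (maxn (maxn n1 n2) (maxn n3 (2 * (b + q.+3)))) => n.
rewrite !geq_max -!andbA => /and4P[/n1P {}n1P /n2P {}n2P /n3P {}n3P nb].
have bn : (b < n)%N by lia.
pose W := initial n b.
have cW : #|W| = b by rewrite card_initial // ltnW.
pose v0 : 'I_n := Ordinal (leq_ltn_trans (leq0n b) bn).
pose u0 : 'I_n := Ordinal bn.
have v0W : v0 \in W by rewrite inE.
have u0W : u0 \notin W by rewrite inE ltnn.
have nR : 0 < n%:R :> R by rewrite ltr0n; lia.
have half (c m : nat) : (c <= b.+1)%N -> (m <= q.+2)%N ->
    (n%:R / 2 : R) ^+ m <= 'C(n - c, m)%:R * m`!%:R.
  move=> cb mq; apply: bin_ge; first by rewrite divr_ge0.
  rewrite ler_pdivrMr // -natrM ler_nat; lia.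
have half1 : 1 <= n%:R / 2 :> R.
  by rewrite ler_pdivlMr // mul1r ler_nat; lia.
pose P t : R := link_sum (star_on q.+3 W) (core_weight W t) v0.
pose Q t : R := link_sum (star_on q.+3 W) (core_weight W t) u0.
(* The link sums are taken over the polynomial ring, with weight ['X] off [W]; evaluation at [t],
   being a ring morphism, gives back [P t] and [Q t]. *)
pose p : {poly R} := 'X^(q.+2) * link_sum (star_on q.+3 W) (core_weight W 'X) v0
   - link_sum (star_on q.+3 W) (core_weight W 'X) u0.
have pE t : p.[t] = t ^+ q.+2 * P t - Q t.
  have core_horner u : horner_eval t (core_weight W 'X u) = core_weight W t u.
    rewrite /core_weight; case: ifP => _; first by rewrite /horner_eval hornerC.
    by rewrite /horner_eval hornerX.
  rewrite /p hornerD hornerN hornerM hornerXn /P /Q.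
  by rewrite -!(eq_link_sum _ _ core_horner) !(link_sum_rmorph (horner_eval t)).
(* Below, [p] is nonpositive at [D / n] and nonnegative at [tau] for large [n], so that
   [P t = Q t / t ^ (k - 1)] for some [t] in between, by the intermediate value theorem. *)
pose a := D / n%:R.
have D0 : 0 < D by lra.
have a0 : 0 < a by rewrite divr_gt0.
have atau : a <= tau.
  by rewrite ler_pdivrMr // mulrC -ler_pdivrMr.
(* As [a * n = D], [P a] stays bounded, while [Q a / a ^ (q + 1)] is at least a binomial coefficient
   growing with [n]. *)
have pa : p.[a] <= 0.
  rewrite pE subr_le0.
  apply: le_trans (link_star_out_ge (ltW a0) q.+1 u0W).
  rewrite card_ord cW exprSr -mulrA -[_ *+ 'C(_, _)]mulr_natr [leRHS]mulrCA.
  rewrite ler_wpM2l ?exprn_ge0 ?(ltW a0) //.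
  set B := (b%:R + D) ^+ q.+2 in n2P.
  have B0 : 0 <= B by rewrite exprn_ge0 // addr_ge0 // ltW.
  have PB : P a <= B.
    apply: le_trans (link_star_in_le (ltW a0) q.+2 v0W) _.
    apply: (@le_trans _ _ (q.+2`!%:R * elem_sym (core_weight W a) q.+2)); last first.
      apply: le_trans (elem_sym_core_le _ (ltW a0) q.+2) _.
      by rewrite cW card_ord divfK // gt_eqF.
    rewrite ler_peMl ?ler1n ?fact_gt0 //.
    by apply: elem_sym_ge0 => v; apply: core_weight_ge0 (ltW a0) _.
  have BC : B <= 'C(n - b.+1, q.+1)%:R.
    have F0 : 0 < q.+1`!%:R :> R by rewrite ltr0n fact_gt0.
    rewrite -(ler_pM2r F0); apply: le_trans (half _ _ (leqnn _) (leqnSn _)).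
    apply: (@le_trans _ _ (n%:R / 2)); first by lra.
    by rewrite exprS ler_peMr ?exprn_ege1 //; lra.
  have b1 : 1 <= b%:R :> R by rewrite ler1n.
  apply: (@le_trans _ _ B); last by nra.
  apply: le_trans PB; rewrite ler_piMl //; last by apply: le_trans atau _.
  by apply: sumr_ge0 => f _; apply: prod_in_ge0 => v; apply: core_weight_ge0 (ltW a0) _.
(* For constant [tau], [P tau] has order n^(q+2) and [Q tau] only order n^(q+1). *)
have ptau : 0 <= p.[tau].
  rewrite pE subr_ge0.
  apply: le_trans (link_star_out_le (ltW tau0) q.+1 u0W) _.
  have tq : 0 <= tau ^+ q.+2 by rewrite exprn_ge0 // ltW.
  apply: le_trans (ler_wpM2l tq (link_star_in_ge (ltW tau0) q.+2 v0W)).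
  rewrite card_ord cW -[_ *+ 'C(_, _)]mulr_natr mulrA -expr2 -exprM [(q.+2 * 2)%N]mulnC.
  have E1 : elem_sym (core_weight W tau) q.+1 <= 2 ^+ q.+1 * n%:R ^+ q.+1.
    apply: (@le_trans _ _ (q.+1`!%:R * elem_sym (core_weight W tau) q.+1)).
      rewrite ler_peMl ?ler1n ?fact_gt0 //.
      by apply: elem_sym_ge0 => v; apply: core_weight_ge0 (ltW tau0) _.
    apply: le_trans (elem_sym_core_le _ (ltW tau0) q.+1) _.
    have bnR : b%:R <= n%:R :> R by rewrite ler_nat ltnW.
    rewrite -exprMn cW card_ord lerXn2r ?nnegrE ?addr_ge0 ?mulr_ge0 //; first exact: ltW.
    by nra.
  have F0 : 0 < q.+2`!%:R :> R by rewrite ltr0n fact_gt0.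
  have C1 := half b q.+2 (leqnSn _) (leqnn _).
  have T0 : 0 < tau ^+ (2 * q.+2) by rewrite exprn_gt0.
  move: n3P; rewrite ler_pdivrMr // => n3P.
  rewrite -(ler_pM2r F0); apply: (@le_trans _ _ (b%:R * (2 ^+ q.+1 * n%:R ^+ q.+1) * q.+2`!%:R)).
    by rewrite ler_pM2r // ler_wpM2l.
  rewrite -[leRHS]mulrA; apply: le_trans (ler_wpM2l (ltW T0) C1).
  rewrite expr_div_n [leRHS]mulrA ler_pdivlMr ?exprn_gt0 // [2 ^+ q.+2]exprS [n%:R ^+ q.+2]exprS.
  have nq : 0 < n%:R ^+ q.+1 :> R by rewrite exprn_gt0.
  apply: (@le_trans _ _ (n%:R ^+ q.+1 * (2 * (q.+2`!%:R * (2 ^+ q.+1 * b%:R * 2 ^+ q.+1))))).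
    by rewrite le_eqVlt; apply/orP; left; apply/eqP; ring.
  apply: le_trans (ler_wpM2l (ltW nq) n3P) _.
  by rewrite le_eqVlt; apply/orP; left; apply/eqP; ring.
have [|t] := @poly_ivt R p a tau atau.
  by rewrite pa ptau.
move=> /andP[ta ttau] /rootP; rewrite pE => /eqP; rewrite subr_eq0 => /eqP PQ.
have t0 : 0 < t by apply: lt_le_trans ta.
exists t, (P t); split=> //; first by rewrite -ler_pdivrMr.
move=> W' v cW'; have ccW : #|W'| = #|W| by rewrite cW'.
case vW: (v \in W').
  rewrite (@link_sum_star_perm _ _ _ _ W _ _ v0) ?v0W ?vW //.
  by rewrite /core_weight vW expr1n mulr1.
rewrite (@link_sum_star_perm _ _ _ _ W _ _ u0) ?(negbTE u0W) ?vW //.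
by rewrite /core_weight vW mulrC PQ.
Qed.

(** * Stars with missing edges *)

Lemma bernoulli_ge (R : realDomainType) (x : R) (m : nat) :
  0 <= x -> x <= 1 -> 1 - m%:R * x <= (1 - x) ^+ m.
Proof.
move=> x0 x1; elim: m => [|m IH]; first by rewrite expr0 mul0r subr0.
rewrite exprS; have x1' : 0 <= 1 - x by rewrite subr_ge0.
apply: le_trans (ler_wpM2l x1' IH); rewrite -natr1.
have : 0 <= m%:R * x * x by rewrite !mulr_ge0.
by move=> h; rewrite -subr_ge0; move: h; congr (0 <= _); ring.
Qed.

Lemma le_link_sum (R : numDomainType) (V : finType) (E E' : {set {set V}})
    (z z' : V -> R) (v : V) :
  E \subset E' -> (forall u, 0 <= z u <= z' u) ->
  link_sum E z v <= link_sum E' z' v.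
Proof.
move=> /subsetP EE zz; apply: (@le_trans _ _ (link_sum E z' v)).
  by apply: ler_sum => f _; apply: ler_prod => u _.
apply: le_sum_subpred => [f|f /andP[-> /EE]] //.
by apply: prod_in_ge0 => u; case/andP: (zz u) => z0; apply: le_trans.
Qed.

(** The second term of [link_sum_star_out], treated as an error term. *)
Definition multicore_sum (R : pzSemiRingType) (V : finType) (W : {set V}) (m : nat)
    (z : V -> R) (u : V) : R :=
  \sum_(f : {set V} | [&& u \notin f, #|f| == m & (1 < #|f :&: W|)%N])
     \prod_(v in f) z v.

(** Everything follows from [t * n] being large: elementary symmetric sums are at most
    [(2 * t * n) ^ m], and the binomial coefficients at least [(n / 2) ^ m / m!]. The three
    conclusions are what [spectral_radius_deficit] requires. *)
Lemma star_size_estimates (R : realType) (q b n : nat) (W : {set 'I_n}) (t lam : R) :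
  (0 < b)%N -> #|W| = b -> (2 * (b + q.+3) <= n)%N -> 0 < t -> t <= 1 ->
  b%:R <= t * n%:R -> 2 ^+ b.+2 * q.+2`!%:R <= t * n%:R ->
  8 * q.+3%:R * b%:R ^+ 2 * 2 ^+ q * 2 ^+ q.+1 * q.+1`!%:R <= t * n%:R ->
  (forall v, link_sum (star_on q.+3 W) (core_weight W t) v =
             lam * core_weight W t v ^+ q.+2) ->
  [/\ lam <= t ^+ q.+2 * (2 * n%:R) ^+ q.+2, 2 * 2 ^+ b <= lam &
   forall u, u \notin W -> 8 * q.+3%:R * multicore_sum W q.+2 (core_weight W t) u
       <= t ^+ q.+1 *+ 'C(n - b.+1, q.+1)].
Proof.
move=> b0 cW nb t0 t1 Xb X1 X2 eigen.
have [v0 v0W] : exists v, v \in W by apply/card_gt0P; rewrite cW.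
have lamE : lam = link_sum (star_on q.+3 W) (core_weight W t) v0.
  by rewrite eigen /core_weight v0W expr1n mulr1.
have z0 v : 0 <= core_weight W t v by apply: core_weight_ge0 (ltW t0) _.
have half (c m : nat) : (c <= b.+1)%N -> (m <= q.+2)%N ->
    (n%:R / 2 : R) ^+ m <= 'C(n - c, m)%:R * m`!%:R.
  move=> cb mq; apply: bin_ge; first by rewrite divr_ge0.
  rewrite ler_pdivrMr // -natrM ler_nat; lia.
have esym_le m : elem_sym (core_weight W t) m <= (2 * (t * n%:R)) ^+ m.
  apply: (@le_trans _ _ (m`!%:R * elem_sym (core_weight W t) m)).
    by rewrite ler_peMl ?ler1n ?fact_gt0 ?elem_sym_ge0.
  apply: le_trans (elem_sym_core_le _ (ltW t0) m) _.
  rewrite cW card_ord lerXn2r ?nnegrE //; last by lra.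
  - by rewrite addr_ge0 ?mulr_ge0 // ltW.
  - by rewrite mulr_ge0 // mulr_ge0 // ltW.
have X2' : 2 <= t * n%:R.
  apply: le_trans X1; rewrite exprS -mulrA ler_peMr // mulr_ege1 //.
    by rewrite exprn_ege1 //; lra.
  by rewrite ler1n fact_gt0.
have FG m : 0 < m`!%:R :> R by rewrite ltr0n fact_gt0.
split.
- rewrite lamE; apply: le_trans (link_star_in_le (ltW t0) q.+2 v0W) _.
  by rewrite -exprMn mulrCA esym_le.
- rewrite lamE; apply: le_trans (link_star_in_ge (ltW t0) q.+2 v0W).
  rewrite card_ord cW -[_ *+ 'C(_, _)]mulr_natr -(ler_pM2r (FG q.+2)) -[leRHS]mulrA.
  have tq : 0 <= t ^+ q.+2 by rewrite exprn_ge0 // ltW.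
  apply: le_trans (ler_wpM2l tq (half b q.+2 (leqnSn _) (leqnn _))).
  rewrite -exprMn mulrA.
  apply: (@le_trans _ _ (t * n%:R / 2)); first by move: X1; rewrite !exprS; lra.
  by rewrite exprS ler_peMr ?exprn_ege1 //; lra.
- move=> u uW; apply: (@le_trans _ _ (8 * q.+3%:R * (b%:R ^+ 2 * (2 * (t * n%:R)) ^+ q))).
    rewrite ler_wpM2l ?mulr_ge0 //.
    apply: (@le_trans _ _ (b%:R ^+ 2 * elem_sym (core_weight W t) q)); last first.
      by rewrite ler_wpM2l ?exprn_ge0.
    rewrite -[X in X%:R ^+ 2]cW -(sum_core_weight_in W t).
    by apply: (sum_meeting_twice_le z0) => f /and3P[_ -> ->].
  rewrite -[_ *+ 'C(_, _)]mulr_natr -(ler_pM2r (FG q.+1)) -[leRHS]mulrA.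
  have tq : 0 <= t ^+ q.+1 by rewrite exprn_ge0 // ltW.
  apply: le_trans (ler_wpM2l tq (half b.+1 q.+1 (leqnn _) (leqnSn _))).
  have Xq : 0 <= (t * n%:R) ^+ q by rewrite exprn_ge0 // ltW //; lra.
  have P2 : 0 < 2 ^+ q.+1 :> R by rewrite exprn_gt0.
  rewrite [leRHS](_ : _ = (t * n%:R) ^+ q * (t * n%:R) / 2 ^+ q.+1); last first.
    rewrite expr_div_n [t ^+ q.+1]exprS [n%:R ^+ q.+1]exprS exprMn.
    by move: (2 ^+ q.+1)^-1 => h; ring.
  rewrite ler_pdivlMr // exprMn.
  apply: le_trans (ler_wpM2l Xq X2).
  by rewrite le_eqVlt; apply/orP; left; apply/eqP; ring.
Qed.

(** Here [B], [Th], [G], [M] stand for [b], [theta ^ (q + 1)], the main term and the multicore term.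
    The main term loses a fraction [4 * g], against about [3 * g] allowed by
    [(1 - g) * (1 - 2 * g)]; the surplus [Th * G * B * g] pays for the loss on [M], which is small
    compared to [G]. *)
Lemma deficit_out_bound (R : realFieldType) (B Q g Th G M : R) :
  0 <= g -> 1 <= B -> 0 <= Q -> (Q + 3) * (4 * B * g) <= 1 -> 0 <= M ->
  8 * (Q + 3) * M <= G ->
  1 - (Q + 1) * (2 * g) <= Th -> 1 - (Q + 2) * (2 * g) <= (1 - 2 * g) * Th ->
  (B - 4 * B * g) * (Th * G) + M <= (1 - g) * ((1 - 2 * g) * Th) * (B * G + M).
Proof.
move=> g0 b1 Q0 Bg1 M0 MG Th1 Th2.
have Qg0 : 0 <= (Q + 3) * g by apply: mulr_ge0; lra.
have Bg : g <= B * g by rewrite ler_peMl.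
have Qg : 4 * ((Q + 3) * g) <= 1 by nra.
have Th_half : 1 / 2 <= Th by lra.
have QM : 0 <= (Q + 3) * M by apply: mulr_ge0; lra.
have G0 : 0 <= G by lra.
have Bg0 : 0 <= B * g by lra.
have gain : 4 * ((Q + 3) * M) * (B * g) <= Th * G * (B * g).
  apply: ler_wpM2r => //.
  by apply: (@le_trans _ _ (1 / 2 * G)); [lra | apply: ler_wpM2r].
have loss : 1 - (1 - g) * ((1 - 2 * g) * Th) <= 2 * ((Q + 3) * g).
  have g1 : 0 <= 1 - g by nra.
  by have := ler_wpM2l g1 Th2; nra.
have lossM := ler_wpM2l M0 loss.
have lossM' := ler_wpM2l QM Bg.
have sq : 0 <= Th * G * (B * g * g).
  by rewrite mulr_ge0 // mulr_ge0 //; lra.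
have QMg := mulr_ge0 QM g0.
rewrite -subr_ge0 [leRHS](_ : _ = Th * G * (B * g) + 2 * (Th * G * (B * g * g))
  - M * (1 - (1 - g) * ((1 - 2 * g) * Th))); last by ring.
lra.
Qed.

(** The number of missing edges at [v0] is normalized so that they take at least [k * eta * lam],
    with [k = q + 3], from the link sum there. This leaves room to lower the weight of [v0] to
    [1 - eta], which in turn helps all other vertices. *)
Lemma spectral_radius_deficit (R : realType) (q b n : nat) (H : kgraph q.+3 'I_n)
    (W : {set 'I_n}) (t lam eta : R) (v0 : 'I_n) :
  (0 < b)%N -> #|W| = b -> 0 < t -> t <= 1 -> (0 < n)%N ->
  (forall v, link_sum (star_on q.+3 W) (core_weight W t) v =
             lam * core_weight W t v ^+ q.+2) ->
  lam <= t ^+ q.+2 * (2 * n%:R) ^+ q.+2 -> 2 * 2 ^+ b <= lam ->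
  (forall u, u \notin W -> 8 * q.+3%:R * multicore_sum W q.+2 (core_weight W t) u
       <= t ^+ q.+1 *+ 'C(n - b.+1, q.+1)) ->
  edges H \subset star_on q.+3 W -> v0 \in W ->
  #|[set f : {set 'I_n} | (v0 \notin f) && (v0 |: f \in star_on q.+3 W :\: edges H)]|%:R
    = q.+3%:R * eta * (2 * n%:R) ^+ q.+2 ->
  spectral_radius R H <= (1 - eta / (4 * b%:R)) * lam.
Proof.
move=> b0 cW t0 t1 n0 eigen lam_le lam_ge multi HS v0W.
set miss := [set f | _] => missE.
pose z := core_weight W t.
have z0 v : 0 < z v by rewrite /z /core_weight; case: ifP.
have zge0 v : 0 <= z v by exact: ltW.
have tz v : t <= z v by rewrite /z /core_weight; case: ifP.
have z1 v : z v <= 1 by rewrite /z /core_weight; case: ifP.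
have lam0 : 0 < lam by apply: lt_le_trans lam_ge; rewrite mulr_gt0 ?exprn_gt0.
have b1 : 1 <= b%:R :> R by rewrite ler1n.
have T0 : 0 < t ^+ q.+2 by rewrite exprn_gt0.
have k3 : 3 <= q.+3%:R :> R by rewrite ler_nat.
have N0 : 0 < (2 * n%:R : R) ^+ q.+2 by rewrite exprn_gt0 // mulr_gt0 // ltr0n.
have eta0 : 0 <= eta.
  have : 0 <= q.+3%:R * eta * (2 * n%:R) ^+ q.+2 by rewrite -missE.
  by rewrite pmulr_lge0 // pmulr_rge0.
(* All weights are at least [t], so each missing link set contributes at least [t ^ (q + 2)]. *)
have linkH_v0 : link_sum (edges H) z v0 <= lam - #|miss|%:R * t ^+ q.+2.
  have := eigen v0; rewrite {2}/core_weight v0W expr1n mulr1 => <-.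
  rewrite lerBrDr /link_sum [leRHS](bigID (fun f => v0 |: f \in edges H)) /=.
  apply: lerD.
    apply: le_sum_subpred => [f|f /andP[-> fE]]; first exact: prod_in_ge0.
    by rewrite fE (subsetP HS).
  rewrite mulr_natl -sumr_const.
  rewrite [leLHS](eq_bigl (fun f : {set 'I_n} =>
     (v0 \notin f) && (v0 |: f \in star_on q.+3 W) && (v0 |: f \notin edges H))); last first.
    by move=> f; rewrite inE in_setD -andbA [X in _ && X]andbC.
  apply: ler_sum => f /andP[].
  rewrite star_link_in // => /andP[_ /eqP cf] _.
  rewrite -[X in t ^+ X]cf -prodr_const; apply: ler_prod => u _.
  by rewrite tz ltW.
(* The link sum that remains at [v0] is nonnegative. *)
have xi1 : q.+3%:R * eta <= 1.
  have linkH0 : 0 <= link_sum (edges H) z v0 by apply: sumr_ge0 => f _; apply: prod_in_ge0.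
  rewrite -(ler_pM2r N0) mul1r -missE -(ler_pM2r T0).
  by apply: le_trans (_ : _ <= lam) _; [lra | rewrite mulrC].
have linkH_v0' : link_sum (edges H) z v0 <= (1 - q.+3%:R * eta) * lam.
  apply: le_trans linkH_v0 _; rewrite missE mulrBl mul1r lerD2l lerN2 -mulrA.
  by rewrite ler_wpM2l ?mulr_ge0 // mulrC.
have eta3 : 3 * eta <= 1 by nra.
pose g := eta / (4 * b%:R).
have gE : eta = 4 * b%:R * g by rewrite /g mulrC divfK // gt_eqF //; lra.
have g0 : 0 <= g by rewrite /g divr_ge0 //; lra.
have geta : 4 * g <= eta by nra.
pose theta := 1 - 2 * g.
have th0 : 0 < theta by rewrite /theta; lra.
have th1 : theta <= 1 by rewrite /theta; lra.
pose z' v := if v == v0 then 1 - eta else if v \in W then 1 else theta * t.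
have z'0 v : 0 < z' v.
  rewrite /z'; case: ifP => _; first by lra.
  by case: ifP => _ //; rewrite mulr_gt0.
have z'ge0 v : 0 <= z' v by exact: ltW.
have z'z v : 0 <= z' v <= z v.
  rewrite z'ge0 /= /z' /z /core_weight; case: eqP => [->|_].
    by rewrite v0W; lra.
  by case: ifP => _ //; rewrite ler_piMl // ltW.
have z'le1 v : z' v <= 1 by case/andP: (z'z v) => _ /le_trans; apply.
have z'out v : v \notin W -> z' v = theta * z v.
  move=> vW; rewrite /z' /z /core_weight (negbTE vW); case: eqP => // e.
  by rewrite e v0W in vW.
have qk : q.+3%:R = q%:R + 3 :> R by rewrite -(addn3 q) natrD.
have bernoulli_theta m : 1 - m%:R * (2 * g) <= theta ^+ m.
  by apply: bernoulli_ge; lra.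
apply: (spectral_radius_le (z := z')) => // [|v].
  by rewrite mulr_ge0 // -/g; [lra | exact: ltW].
rewrite -/g.
have linkH_star u : link_sum (edges H) z' u <= link_sum (star_on q.+3 W) z' u.
  by apply: le_link_sum HS _ => x; rewrite z'ge0 lexx.
(* Off [W], the core weights now sum to [b - eta] instead of [b]. *)
have [vW|vW] := boolP (v \in W); last first.
  apply: le_trans (linkH_star v) _.
  rewrite link_sum_star_out // z'out // exprMn.
  have := eigen v; rewrite link_sum_star_out //.
  rewrite sum_core_weight_in cW sum_draws_core // card_ord cW -/z.
  rewrite -/(multicore_sum W q.+2 z v).
  have := multi v vW; rewrite -/z; set G := t ^+ _ *+ _; set M := multicore_sum _ _ _ _.
  move=> MG eigenv.
  have M0 : 0 <= M by apply: sumr_ge0 => f _; apply: prod_in_ge0.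
  have -> : \sum_(w in W) z' w = b%:R - eta.
    rewrite (big_setD1 v0) //= (eq_bigr (fun=> 1)).
      rewrite sumr_const /z' eqxx -cW (cardsD1 v0 W) v0W add1n -natr1; ring.
    by move=> w; rewrite in_setD1 /z' => /andP[/negbTE-> ->].
  have -> : \sum_(g0 : {set 'I_n} | (g0 \subset ~: (v |: W)) && (#|g0| == q.+1))
      \prod_(u in g0) z' u
      = theta ^+ q.+1 * G.
    rewrite (@sum_draws_const _ _ _ _ _ (theta * t)); last first.
      move=> u; rewrite !inE negb_or => /andP[_ uW].
      by rewrite z'out // /z /core_weight (negbTE uW).
    by rewrite cardsCs setCK cardsU1 vW card_ord cW exprMn mulrnAr.
  have M'M : \sum_(f : {set 'I_n} | [&& v \notin f, #|f| == q.+2 & (1 < #|f :&: W|)%N])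
      \prod_(u in f) z' u <= M.
    by apply: ler_sum => f _; apply: ler_prod => u _; apply: z'z.
  apply: le_trans (lerD (lexx _) M'M) _.
  rewrite [leRHS](_ : _ = (1 - g) * theta ^+ q.+2 * (lam * z v ^+ q.+2)); last by ring.
  rewrite -eigenv [theta ^+ q.+2]exprS.
  have B1 := bernoulli_theta q.+1.
  have B2 := bernoulli_theta q.+2.
  rewrite exprS in B2.
  have q1 : q.+1%:R = q%:R + 1 :> R by rewrite -natr1.
  have q2 : q.+2%:R = q%:R + 2 :> R by rewrite -(addn2 q) natrD.
  rewrite qk q1 q2 gE in B1 B2 MG xi1 *.
  exact: (deficit_out_bound g0 b1 (ler0n R q) xi1 M0 MG B1 B2).
(* At [v0], Bernoulli's inequality gives [1 - k * eta <= (1 - g) * (1 - eta) ^ (k - 1)], as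
   [g <= eta / 4]. *)
have [->|vv0] := eqVneq v v0.
  apply: le_trans (le_link_sum v0 (subxx _) z'z) _.
  apply: le_trans linkH_v0' _.
  rewrite mulrAC ler_pM2r // /z' eqxx.
  have := @bernoulli_ge R eta q.+2 eta0.
  have -> : q.+2%:R = q%:R + 2 :> R by rewrite -(addn2 q) natrD.
  move=> /(_ ltac:(lra)) be.
  have g1 : 0 <= 1 - g by lra.
  have /= := ler_wpM2l g1 be; rewrite -/z'; nra.
apply: le_trans (linkH_star v) _.
rewrite /z' (negbTE vv0) vW expr1n mulr1.
(* At the other core vertices, each link set with a vertex off [W] gains a factor [theta]; sets
   inside [W] may not. *)
have prod_le (f : {set 'I_n}) : \prod_(u in f) z' u <=
    theta * \prod_(u in f) z u + (1 - theta) * (f \subset W)%:R.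
  case fW: (f \subset W); last first.
    have [x xf xW] : exists2 x, x \in f & x \notin W.
      by apply/subsetPn; rewrite fW.
    rewrite mulr0 addr0 (big_setD1 x) //= [in leRHS](big_setD1 x) //= z'out // -mulrA.
    rewrite ler_wpM2l ?(ltW th0) // ler_wpM2l //.
    by apply: ler_prod => u _.
  rewrite (_ : \prod_(u in f) z u = 1).
    by rewrite !mulr1 addrC subrK; apply: prodr_ile1 => u _; rewrite z'ge0 z'le1.
  by apply: big1 => u /(subsetP fW) uW; rewrite /z /core_weight uW.
have := eigen v; rewrite {2}/core_weight vW expr1n mulr1 /link_sum => eigenv.
apply: le_trans (ler_sum _ (fun f _ => prod_le f)) _.
rewrite big_split /= -!big_distrr /= eigenv.
(* At most [2 ^ b <= lam / 2] sets lie inside [W], so half of the gain [2 * g * lam] survives. *)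
have : \sum_(f : {set 'I_n} | (v \notin f) && (v |: f \in star_on q.+3 W))
    (f \subset W)%:R <= 2 ^+ b :> R.
  rewrite -cW -natrX -card_powerset -sum1_card natr_sum.
  rewrite [leRHS]big_mkcond [leLHS]big_mkcond /=; apply: ler_sum => f _.
  by rewrite powersetE; case: ifP => _; case: (f \subset W); rewrite /= ?lexx ?ler01.
set S := \sum_(f | _) _ => SE.
have : (2 * g) * S <= (2 * g) * (lam / 2).
  by apply: ler_wpM2l; [rewrite mulr_ge0 | clear -SE lam_ge; lra].
clear; rewrite /theta; lra.
Qed.

(** * Hypergraphs with fewer than [b] heavy vertices *)

Lemma card_link (V : finType) (E : {set {set V}}) (v : V) :
  #|[set f : {set V} | (v \notin f) && (v |: f \in E)]| = #|[set e in E | v \in e]|.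
Proof.
rewrite -!sum1_card.
rewrite [RHS](eq_bigl (fun e : {set V} => (v \in e) && (e \in E))); last first.
  by move=> e; rewrite inE andbC.
by rewrite big_set_through; apply: eq_bigl => f; rewrite inE.
Qed.

Lemma card_link_set (m : nat) (V : finType) (H : kgraph m.+1 V) (v : V) (f : {set V}) :
  v \notin f -> v |: f \in edges H -> #|f| = m.
Proof. by move=> vf /edges_uniform; rewrite cardsU1 vf => -[]. Qed.

Lemma le_exprn (R : numDomainType) (m : nat) (x y : R) :
  0 <= x -> x <= y -> x ^+ m <= y ^+ m.
Proof. by move=> x0 xy; rewrite lerXn2r ?nnegrE // (le_trans x0). Qed.

(** [1 - 2 * g + eps <= (1 - g) * (1 - eps)], and a single factor [1 - g] is enough. *)
Lemma few_heavy_in_bound (R : realFieldType) (g eps X : R) (m : nat) :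
  0 <= g -> g <= 1 / 8 -> 0 <= eps -> 12 * eps <= g -> 0 <= X ->
  ((1 - 2 * g + eps) * X) ^+ m.+1 <= (1 - g) * ((1 - eps) * X) ^+ m.+1.
Proof.
move=> g0 g8 eps0 eps12 X0; have g1 : 0 <= 1 - g by lra.
apply: (@le_trans _ _ (((1 - g) * ((1 - eps) * X)) ^+ m.+1)).
  apply: le_exprn; first by apply: mulr_ge0 => //; lra.
  by rewrite mulrA ler_wpM2r //; nra.
rewrite exprMn ler_wpM2r //; first by apply/exprn_ge0/mulr_ge0 => //; lra.
by rewrite exprS ler_piMr // exprn_ile1 //; lra.
Qed.

(** Since [g * b = 1 / 8], multiplying [b] by [(1 - g) ^ 2 * (1 - 2 * g)] costs at most [1 / 2]. One
    factor [1 - g] then absorbs the errors in [eps], through Bernoulli's inequality with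
    [4 * eps]. *)
Lemma few_heavy_out_bound (R : realFieldType) (b g eps X : R) (m : nat) :
  0 <= g -> g <= 1 / 8 -> 0 <= eps -> 12 * eps <= g -> 0 <= X -> 8 * g * b = 1 ->
  4 * eps * m%:R <= g -> 1 <= b ->
  (b - 3 / 4) * ((1 - 2 * g + eps) * X) ^+ m
    <= (1 - g) * (1 - 2 * g) * b * ((1 - 2 * g) * (1 - eps) * X) ^+ m.
Proof.
move=> g0 g8 eps0 eps12 X0 gb epsm b1.
have d0 : 0 <= (1 - g) * (1 - 2 * g) * b.
  by apply: mulr_ge0; [apply: mulr_ge0; lra | lra].
have Y0 : 0 <= (1 - 2 * g + eps) * X by apply: mulr_ge0 => //; lra.
apply: (@le_trans _ _
    ((1 - g) * (1 - 2 * g) * b * ((1 - g) * ((1 - 2 * g + eps) * X) ^+ m))).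
  rewrite [leRHS]mulrA ler_wpM2r ?exprn_ge0 //.
  have gb8 : g * b = 1 / 8 by lra.
  have : g * g * b = g / 8 by rewrite -mulrA gb8; lra.
  have : g * g * g * b = g * g / 8 by rewrite -mulrA gb8; lra.
  nra.
apply: ler_wpM2l => //.
apply: (@le_trans _ _ (((1 - 4 * eps) * ((1 - 2 * g + eps) * X)) ^+ m)).
  rewrite [leRHS]exprMn ler_wpM2r ?exprn_ge0 //.
  by apply: le_trans (@bernoulli_ge R (4 * eps) m _ _); lra.
apply: le_exprn; first by apply: mulr_ge0 => //; lra.
by rewrite [leLHS]mulrA ler_wpM2r //; nra.
Qed.

(** The hypothesis on [N] says that [lam] is at least of order [N / t]; for small [t] this beats
    constant multiples of [N]. *)
Lemma few_heavy_cover_bound (R : realFieldType) (g b K t lam N P S F : R) :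
  0 <= g -> g <= 1 / 8 -> 1 <= b -> 0 <= K -> 0 < t -> t <= 1 -> 0 <= N -> 0 < P ->
  0 <= S -> S <= 1 -> 0 < F ->
  N <= P * (lam * t * F) -> t * ((b + K) * (2 * P) * F) <= S ->
  b * (t * N) + K * N * S <= (1 - g) * lam * S.
Proof.
move=> g0 g8 b1 K0 t0 t1 N0 P0 S0 S1 F0 NP tK.
have Y0 : 0 < t * (2 * P * F) by rewrite !mulr_gt0.
have Yge0 := ltW Y0.
rewrite -(ler_pM2r Y0); set Y := t * _ in Y0 Yge0 *.
have bY : t * (b * Y) <= b * Y by rewrite ler_piMl // mulr_ge0 //; lra.
have KY : S * (K * Y) <= K * Y by rewrite ler_piMl // mulr_ge0.
apply: (@le_trans _ _ (N * S)).
  rewrite [leLHS](_ : _ = N * (t * (b * Y) + S * (K * Y))); last by ring.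
  rewrite ler_wpM2l //; apply: le_trans (lerD bY KY) _.
  by rewrite -mulrDl [leLHS](_ : _ = t * ((b + K) * (2 * P) * F)) // /Y; ring.
rewrite [leRHS](_ : _ = 2 * (1 - g) * (P * (lam * t * F)) * S); last by rewrite /Y; ring.
have PF0 := le_trans N0 NP.
rewrite ler_wpM2r //; apply: le_trans NP _.
by rewrite ler_peMl //; lra.
Qed.

(** [W] is the heavy set and [T] a cover. The value of [s] makes the light part of [T] weigh at most
    [1 / 4], hence [T] at most [b - 3 / 4]. This falls short of the core weight [b] of the star by a
    constant, which is the source of [g]. *)
Lemma spectral_radius_few_heavy (R : realType) (q b K n : nat) (H : kgraph q.+3 'I_n)
    (W0 W T : {set 'I_n}) (t lam g eps s : R) :
  8 * g * b%:R = 1 -> 4 * eps * q.+3%:R = g -> 4 * s * (q.+3%:R * b%:R) = 1 ->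
  #|W0| = b -> 0 < t -> t <= 1 -> (b < n)%N ->
  (forall v, link_sum (star_on q.+3 W0) (core_weight W0 t) v =
             lam * core_weight W0 t v ^+ q.+2) ->
  (b + q.+3)%:R <= eps * n%:R -> b%:R <= eps * (t * n%:R) -> t <= s ->
  t * ((b + K)%:R * 2 ^+ q.+2 * q.+1`!%:R) <= s ^+ q.+2 ->
  (#|W| < b)%N -> (#|T| <= q.+3 * b)%N ->
  (forall e, e \in edges H -> e :&: T != set0) ->
  (forall v, v \notin W -> (degree H v <= K * n ^ q.+1)%N) ->
  spectral_radius R H <= (1 - g) * lam.
Proof.
move=> gb epsk skb.
have [b_eq0|b0] := posnP b; first by move: gb; rewrite b_eq0; lra.
have b1 : 1 <= b%:R :> R by rewrite ler1n.
have k3 : 3 <= q.+3%:R :> R by rewrite ler_nat.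
have g0 : 0 < g by nra.
have g8 : g <= 1 / 8 by nra.
have eps0 : 0 < eps by nra.
have eps12 : 12 * eps <= g by nra.
have kb3 : 3 <= q.+3%:R * b%:R :> R by nra.
have s0 : 0 < s by nra.
have s1 : s <= 1 by nra.
have g1 : 0 <= 1 - g by lra.
have eps_gt0 : 0 < 1 - eps by lra.
have eps1 := ltW eps_gt0.
have eps_half : 1 / 2 <= 1 - eps by lra.
have epsq : 4 * eps * q.+1%:R <= g.
  rewrite -[leRHS]epsk; apply: ler_wpM2l; first by lra.
  by rewrite ler_nat; exact: leqW (leqnSn _).
pose theta := 1 - 2 * g.
have th0 : 0 < theta by rewrite /theta; lra.
have th1 : theta <= 1 by rewrite /theta; lra.
have thge0 := ltW th0.
have te0 : 0 <= theta + eps by lra.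
have te1 : theta + eps <= 1 by rewrite /theta; lra.
have skb4 : s * (q.+3%:R * b%:R) = 1 / 4 by lra.
have b34 : 0 <= b%:R - 3 / 4 :> R by lra.
move=> cW0 t0 t1 bn eigen epsn epsX ts tK Wb Tb HT low.
set X := t * n%:R in epsX.
have nR : 0 < n%:R :> R by rewrite ltr0n; apply: leq_ltn_trans bn.
have X0 : 0 < X by rewrite mulr_gt0.
have [Xge0 tge0 sge0] := And3 (ltW X0) (ltW t0) (ltW s0).
have FG m : 0 < m`!%:R :> R by rewrite ltr0n fact_gt0.
have nbq : (b + q.+3 <= n)%N.
  by rewrite -(ler_nat R); apply: le_trans epsn _; rewrite ler_piMl //; clear -g8 eps12; lra.
have binge (c m : nat) : (c <= b.+1)%N -> (m <= q.+2)%N ->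
    ((1 - eps) * n%:R : R) ^+ m <= 'C(n - c, m)%:R * m`!%:R.
  move=> cb mq; apply: bin_ge; first by apply: mulr_ge0.
  apply: (@le_trans _ _ (n - (b + q.+3))%:R).
    by rewrite natrB // mulrBl mul1r lerD2l lerN2.
  by rewrite ler_nat -subnDA leq_sub2l // -addSnnS leq_add.
(* Both lower bounds on [lam] come from the eigenvalue equation of the star on [W0], at a vertex in
   the core and at one outside it. *)
have lam_in : ((1 - eps) * X) ^+ q.+2 <= lam * q.+2`!%:R.
  have [v vW0] : exists v, v \in W0 by apply/card_gt0P; rewrite cW0.
  have := link_star_in_ge (ltW t0) q.+2 vW0.
  rewrite eigen {1}/core_weight vW0 expr1n mulr1 card_ord cW0 -[_ *+ 'C(_, _)]mulr_natr.
  rewrite -(ler_pM2r (FG q.+2)); apply: le_trans.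
  rewrite /X mulrCA exprMn -[leRHS]mulrA ler_wpM2l ?exprn_ge0 //.
  exact: binge.
have lam_out : b%:R * ((1 - eps) * n%:R) ^+ q.+1 <= lam * t * q.+1`!%:R.
  have [v vW0] : exists v, v \notin W0.
    have : (0 < #|~: W0|)%N by rewrite cardsCs setCK card_ord cW0 subn_gt0.
    by case/card_gt0P => v; rewrite inE => ?; exists v.
  have := link_star_out_ge (ltW t0) q.+1 vW0.
  rewrite eigen {1}/core_weight (negbTE vW0) card_ord cW0 -[_ *+ 'C(_, _)]mulr_natr.
  rewrite [t ^+ q.+2]exprSr mulrCA [leRHS]mulrCA ler_pM2l ?exprn_gt0 //.
  rewrite -(ler_pM2r (FG q.+1)); apply: le_trans.
  by rewrite -mulrA ler_wpM2l // binge.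
have lam0 : 0 < lam.
  rewrite -(pmulr_lgt0 _ (FG q.+2)); apply: lt_le_trans lam_in.
  by rewrite exprn_gt0 // mulr_gt0.
pose z v := if v \in W then 1 else if v \in T then s else theta * t.
have z0 v : 0 < z v.
  by rewrite /z; case: ifP => // _; case: ifP => // _; rewrite mulr_gt0.
have zge0 v : 0 <= z v by exact: ltW.
have tt : theta * t <= s by apply: le_trans ts; rewrite ler_piMl.
have zW v : v \notin W -> z v <= s.
  by move=> /negbTE vW; rewrite /z vW; case: ifP.
have sumW : \sum_(v in W) z v <= b%:R - 1.
  rewrite (eq_bigr (fun=> 1)); last by move=> v vW; rewrite /z vW.
  by rewrite sumr_const lerBrDr -[1 in leLHS]/(1%N%:R) -natrD ler_nat addn1.
have sumTW : \sum_(v in T | v \notin W) z v <= 1 / 4.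
  rewrite -skb4; apply: (@le_trans _ _ (\sum_(v in T) s)).
    apply: (@le_trans _ _ (\sum_(v in T | v \notin W) s)).
      by apply: ler_sum => v /andP[_ vW]; apply: zW.
    by apply: le_sum_subpred => [v|v /andP[]] //; lra.
  rewrite sumr_const -[leLHS]mulr_natr ler_wpM2l //.
  by rewrite -natrM ler_nat.
have sumT : \sum_(v in T) z v <= b%:R - 3 / 4.
  rewrite (bigID (mem W)) /=.
  have : \sum_(v in T | v \in W) z v <= \sum_(v in W) z v.
    by apply: le_sum_subpred => // v /andP[].
  clear -sumW sumTW; lra.
(* The weight of [W] and [T] together is at most [b <= eps * X]. *)
have sumZ : \sum_v z v <= (theta + eps) * X.
  rewrite (bigID (mem W)) /= (bigID (mem T) (fun v => v \notin W)) /=.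
  rewrite (eq_bigl (fun v => (v \in T) && (v \notin W)) _ (fun v => andbC _ _)).
  have : \sum_(v | (v \notin W) && (v \notin T)) z v <= theta * X.
    apply: (@le_trans _ _ (\sum_(v : 'I_n) theta * t)).
      apply: (@le_trans _ _ (\sum_(v : 'I_n | (v \notin W) && (v \notin T)) theta * t)).
        by apply: ler_sum => v /andP[/negbTE vW /negbTE vT]; rewrite /z vW vT.
      by apply: le_sum_subpred => // v; rewrite mulr_ge0.
    by rewrite sumr_const card_ord -[leLHS]mulr_natr mulrA.
  clear -sumW sumTW epsX; lra.
have esym m : m`!%:R * elem_sym z m <= ((theta + eps) * X) ^+ m.
  apply: le_trans (fact_elem_sym_le zge0 m) _.
  by apply: le_exprn sumZ; apply: sumr_ge0.
apply: (spectral_radius_le (z := z)) => // [|v].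
  by rewrite mulr_ge0 // ltW.
have [vW|vW] := boolP (v \in W).
  rewrite /z vW expr1n mulr1 -/z -(ler_pM2r (FG q.+2)).
  apply: (@le_trans _ _ (elem_sym z q.+2 * q.+2`!%:R)).
    rewrite ler_pM2r //; apply: le_sum_subpred => [f|f /andP[vf fE]].
      exact: prod_in_ge0.
    by apply/eqP; apply: card_link_set fE.
  rewrite mulrC; apply: le_trans (esym _) _; rewrite -mulrA.
  apply: le_trans (ler_wpM2l g1 lam_in).
  by apply: few_heavy_in_bound => //; exact: ltW.
have [vT|vT] := boolP (v \in T).
  have zv : z v = s by rewrite /z (negbTE vW) vT.
  rewrite zv /link_sum (bigID (fun f : {set 'I_n} => f :&: W != set0)) /=.
  set S := s ^+ q.+2 in tK *; set F := q.+1`!%:R in tK.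
  have S0 : 0 < S by rewrite exprn_gt0.
  have S1 : S <= 1 by rewrite exprn_ile1 // ltW.
  have N0 : 0 < n%:R ^+ q.+1 :> R by rewrite exprn_gt0.
  have esym1 : elem_sym z q.+1 <= t * n%:R ^+ q.+1.
    apply: (@le_trans _ _ (q.+1`!%:R * elem_sym z q.+1)).
      by rewrite ler_peMl ?ler1n ?fact_gt0 ?elem_sym_ge0.
    apply: le_trans (esym _) _; apply: (@le_trans _ _ (X ^+ q.+1)).
      by apply: le_exprn; [apply: mulr_ge0 | rewrite ler_piMl].
    rewrite exprMn ler_wpM2r ?(ltW N0) // exprS ler_piMr //.
    by rewrite exprn_ile1.
  have meetW : \sum_(f : {set 'I_n} | (v \notin f) && (v |: f \in edges H) && (f :&: W != set0))
      \prod_(u in f) z u <= b%:R * (t * n%:R ^+ q.+1).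
    apply: le_trans (sum_meeting_le (T := W) (m := q.+1) zge0 _) _.
      by move=> f /andP[/andP[vf fE] ->]; rewrite (card_link_set vf fE) eqxx.
    apply: ler_pM => //; [exact: sumr_ge0 | exact: elem_sym_ge0 |].
    by apply: le_trans sumW _; rewrite lerBlDr lerDl.
  (* Off [W] all weights are at most [s], and [v] is not heavy. *)
  have avoidW : \sum_(f : {set 'I_n} | (v \notin f) && (v |: f \in edges H) && ~~ (f :&: W != set0))
      \prod_(u in f) z u <= K%:R * n%:R ^+ q.+1 * S.
    apply: (@le_trans _ _ (\sum_(f : {set 'I_n} | (v \notin f) && (v |: f \in edges H)) S)).
      apply: (@le_trans _ _ (\sum_(f : {set 'I_n} |
          (v \notin f) && (v |: f \in edges H) && ~~ (f :&: W != set0)) S)).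
        apply: ler_sum => f /andP[/andP[vf fE]]; rewrite negbK setI_eq0 => fW.
        rewrite /S -(card_link_set vf fE) -prodr_const; apply: ler_prod => u uf.
        by rewrite zge0 zW // (disjointFr fW uf).
      by apply: le_sum_subpred => [f|f /andP[]] //; exact: ltW.
    rewrite [leLHS](eq_bigl (fun f => f \in
        [set f : {set 'I_n} | (v \notin f) && (v |: f \in edges H)])); last first.
      by move=> f; rewrite inE.
    rewrite sumr_const card_link -[leLHS]mulr_natl ler_wpM2r ?(ltW S0) //.
    by rewrite -natrX -natrM ler_nat; apply: low.
  apply: le_trans (lerD meetW avoidW) _.
  apply: (@few_heavy_cover_bound _ g b%:R K%:R t lam (n%:R ^+ q.+1) (2 ^+ q.+1) S F);
    rewrite ?exprn_gt0 ?FG //; try exact: ltW.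
    rewrite -ler_pdivrMl ?exprn_gt0 //; apply: le_trans lam_out.
    rewrite mulrC -expr_div_n; apply: (@le_trans _ _ (((1 - eps) * n%:R) ^+ q.+1)).
      apply: le_exprn; first by rewrite divr_ge0.
      by rewrite mulrC -[2^-1]mul1r ler_wpM2r.
    by rewrite ler_peMl // exprn_ge0 // mulr_ge0.
  by rewrite -natrD -exprS.
have zv : z v = theta * t by rewrite /z (negbTE vW) (negbTE vT).
rewrite zv -(ler_pM2r (FG q.+1)).
have linkT : link_sum (edges H) z v <= (b%:R - 3 / 4) * elem_sym z q.+1.
  apply: (@le_trans _ _ ((\sum_(w in T) z w) * elem_sym z q.+1)).
    apply: sum_meeting_le => // f /andP[vf fE].
    rewrite (card_link_set vf fE) eqxx /=.
    have := HT _ fE; rewrite setIUl.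
    suff -> : [set v] :&: T = set0 by rewrite set0U.
    by apply/eqP; rewrite setI_eq0 disjoints1.
  by rewrite ler_wpM2r ?elem_sym_ge0.
apply: (@le_trans _ _ ((b%:R - 3 / 4) * ((theta + eps) * X) ^+ q.+1)).
  apply: le_trans (ler_wpM2r (ltW (FG _)) linkT) _.
  by rewrite -mulrA [elem_sym _ _ * _]mulrC ler_wpM2l.
have c0 : 0 <= (1 - g) * theta ^+ q.+2 * t ^+ q.+1.
  by apply: mulr_ge0; [apply: mulr_ge0 => // | ]; apply: exprn_ge0.
rewrite [leRHS](_ : _ = (1 - g) * theta ^+ q.+2 * t ^+ q.+1 * (lam * t * q.+1`!%:R)); last first.
  by rewrite exprMn [t ^+ q.+2]exprSr; ring.
apply: le_trans (ler_wpM2l c0 lam_out).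
rewrite [leRHS](_ : _ = (1 - g) * theta * b%:R * (theta * (1 - eps) * X) ^+ q.+1); last first.
  by rewrite /X !exprMn [theta ^+ q.+2]exprS; ring.
by apply: few_heavy_out_bound => //; exact: ltW.
Qed.

(** * Counting missing edges after relabeling, and conclusion *)

(** As [E] lies in the star, the symmetric difference consists of the images of the missing edges,
    each of which passes through some vertex of [W]. *)
Lemma card_symdiff_relabel_le (R : numDomainType) (V : finType) (k : nat)
    (W : {set V}) (E : {set {set V}}) (s : {perm V}) :
  E \subset star_on k W ->
  #|symdiff (relabel s E) (star_on k [set s v | v in W])|%:R <=
  \sum_(v in W)
    #|[set f : {set V} | (v \notin f) && (v |: f \in star_on k W :\: E)]|%:R :> R.
Proof.
move=> /subsetP ES.
apply: (@le_trans _ _ #|star_on k W :\: E|%:R).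
  rewrite ler_nat -[leqRHS](card_imset _ (imset_inj (@perm_inj _ s))).
  apply/subset_leq_card/subsetP => x.
  rewrite in_setU !in_setD => /orP[/andP[xS /imsetP[e eE xE]]|/andP[xE xS]].
    by case/negP: xS; rewrite xE mem_star_on_perm ES.
  have [y xy] : exists y : {set V}, x = [set s v | v in y].
    exists [set (s^-1)%g v | v in x]; rewrite -imset_comp -[LHS]imset_id.
    by apply: eq_imset => v /=; rewrite permKV.
  rewrite xy mem_star_on_perm in xS; apply/imsetP; exists y => //.
  rewrite in_setD xS andbT; apply: contra xE => yE.
  by apply/imsetP; exists y.
rewrite -sum1_card natr_sum.
apply: le_trans; first apply: (@le_sum_cover _ R _ W (fun e => e \in star_on k W :\: E)
  (fun w e => (e \in star_on k W :\: E) && (w \in e)) (fun=> 1%:R)) => //.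
  move=> e eD; have /set0Pn[w /setIP[we wW]] : e :&: W != set0.
    by move: eD; rewrite in_setD inE => /and3P[].
  by exists w; rewrite // eD.
apply: ler_sum => w _; rewrite card_link -sum1_card natr_sum le_eqVlt.
by apply/orP; left; apply/eqP/eq_bigl => e; rewrite inE.
Qed.

Theorem theorem1p1 (R : realType) (k beta : nat)
    (hk : (3 <= k)%N) (hbeta : (2 <= beta)%N) :
  exists (C : R) (n0 : nat) (delta_star : R),
    0 < C /\ 0 < delta_star /\
    forall (n : nat) (delta : R) (H : kgraph k 'I_n),
      (n0 <= n)%N -> 0 <= delta -> delta <= delta_star ->
      (matching_number H <= beta)%N ->
      (1 - delta) * spectral_radius R (star n k beta) <= spectral_radius R H ->
      exists W : {set 'I_n},
        #|W| = beta /\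
        (forall e : {set 'I_n}, e \in edges H -> e :&: W != set0) /\
        exists s : {perm 'I_n},
          [set s v | v in W] = initial n beta /\
          #|symdiff (relabel s (edges H)) (edges (star n k beta))|%:R
            <= C * delta * n%:R ^+ k.-1.
Proof.
case: k hk => [|[|[|q]]] // _.
have b0 : (0 < beta)%N by apply: ltnW.
have b1 : 1 <= beta%:R :> R by rewrite ler1n.
have bR : 0 < beta%:R :> R by rewrite ltr0n.
have kR : 0 < q.+3%:R :> R by rewrite ltr0n.
have k3 : 3 <= q.+3%:R :> R by rewrite ler_nat.
pose g : R := 1 / (8 * beta%:R).
pose eps : R := g / (4 * q.+3%:R).
pose s : R := 1 / (4 * q.+3%:R * beta%:R).
pose K := (q.+3 * beta.+1)%N.
pose L : R := (beta + K)%:R * 2 ^+ q.+2 * q.+1`!%:R.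
have gb : 8 * g * beta%:R = 1 by rewrite /g; field; apply: lt0r_neq0.
have epsk : 4 * eps * q.+3%:R = g 
  by rewrite /eps mulrAC mulrC divfK // gt_eqF // mulr_gt0.
have skb : 4 * s * (q.+3%:R * beta%:R) = 1.
  by rewrite /s mulrAC mul1r [4 * (_ * _)]mulrA mulfV // gt_eqF // !mulr_gt0.
have g0 : 0 < g by rewrite divr_gt0 //; lra.
have g1 : g <= 1 by rewrite ler_pdivrMr //; lra.
have eps0 : 0 < eps by rewrite divr_gt0 //; lra.
have s0 : 0 < s by rewrite divr_gt0 // !mulr_gt0 //; lra.
have s1 : s <= 1 by rewrite ler_pdivrMr ?mulr_gt0 //; nra.
have L0 : 0 < L.
  by rewrite /L; do 2?apply: mulr_gt0; rewrite ?exprn_gt0 ?ltr0n ?fact_gt0 ?addn_gt0 ?b0.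
(* [t <= tau] ensures both [t <= s] and [t * L <= s ^ (q + 2)], as [spectral_radius_few_heavy]
   demands. *)
pose tau := Num.min s (s ^+ q.+2 / L).
have tau0 : 0 < tau by rewrite lt_min s0 divr_gt0 ?exprn_gt0.
have taus : tau <= s by rewrite ge_min lexx.
have tauL : tau <= s ^+ q.+2 / L by rewrite ge_min lexx orbT.
pose D1 : R := beta%:R / eps.
pose D2 : R := 2 ^+ beta.+2 * q.+2`!%:R.
pose D3 : R := 8 * q.+3%:R * beta%:R ^+ 2 * 2 ^+ q * 2 ^+ q.+1 * q.+1`!%:R.
have D10 : 0 <= D1 by rewrite divr_ge0 // ltW.
have D20 : 0 <= D2 by rewrite mulr_ge0 // exprn_ge0.
have D30 : 0 <= D3 by rewrite !mulr_ge0 // exprn_ge0.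
(* A single lower bound on [t * n] that implies all those needed below. *)
have D0 : 1 <= 1 + beta%:R + D1 + D2 + D3 by lra.
have [n1 n1P] := star_eigenpair q b0 tau0 (le_trans taus s1) D0.
have [n2 n2P] := exists_nat_bound ((beta + q.+3)%:R / eps).
(* Each of the [beta] vertices of [W] misses at most [4 * beta * delta * k * (2 * n) ^ (k - 1)]
   edges. Taking [delta <= g / 2] excludes a heavy set smaller than [beta]. *)
exists (4 * beta%:R ^+ 2 * q.+3%:R * 2 ^+ q.+2), (maxn (maxn n1 n2) (2 * (beta + q.+3))), (g / 2).
have P2 : 0 < 2 ^+ q.+2 :> R by rewrite exprn_gt0.
have B2 : 0 < beta%:R ^+ 2 :> R by rewrite exprn_gt0.
split; first by do 3!apply: mulr_gt0 => //.
split; first by lra.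
move=> n delta H; rewrite !geq_max -andbA => /and3P[/n1P [t [lam [t0 ttau tD eigen]]] /n2P epsn nb].
move=> delta0 deltag matchH rhoH.
have t1 : t <= 1 := le_trans ttau (le_trans taus s1).
have bn : (beta < n)%N.
  by clear -nb; lia.
have n_gt0 : (0 < n)%N by apply: leq_ltn_trans bn.
have nR : 0 < n%:R :> R by rewrite ltr0n.
have Xb : beta%:R <= t * n%:R by lra.
have X1 : D1 <= t * n%:R by lra.
have X2 : D2 <= t * n%:R by lra.
have X3 : D3 <= t * n%:R by lra.
pose W0 := initial n beta.
have cW0 : #|W0| = beta by rewrite card_initial // ltnW.
have size_est (W : {set 'I_n}) (cW : #|W| = beta) :=
  star_size_estimates b0 cW nb t0 t1 Xb X2 X3 (fun v => eigen W v cW).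
have lam0 : 0 < lam.
  by have [_ + _] := size_est W0 cW0; apply: lt_le_trans; rewrite mulr_gt0 ?exprn_gt0.
have rhoS : lam <= spectral_radius R (star n q.+3 beta).
  apply: (spectral_radius_ge (z := core_weight W0 t)) => //; first exact: ltW.
    by move=> v; rewrite /core_weight; case: ifP.
  by move=> v; apply: eigen.
have delta1 : 0 <= 1 - delta by lra.
have rho_lam : (1 - delta) * lam <= spectral_radius R H.
  by apply: le_trans rhoH; apply: ler_wpM2l.
have codeg (a b : 'I_n) : a != b ->
    (#|[set e in edges H | (a \in e) && (b \in e)]| <= n ^ q.+1)%N.
  by move=> ab; have := codegree_le_expn H ab; rewrite card_ord.
pose W := heavy H (n ^ q.+1) K.
have Wle : (#|W| <= beta)%N by apply: card_heavy_le.
have [cW|Wb] := eqVneq #|W| beta; last first.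
  have [T [cT HT]] := matching_cover H isT.
  have : spectral_radius R H <= (1 - g) * lam.
    apply: (@spectral_radius_few_heavy R q beta K n H W0 W T t lam g eps s) => //.
    - by move=> v; apply: eigen.
    - by rewrite mulrC -ler_pdivrMr.
    - by rewrite mulrC -ler_pdivrMr.
    - exact: le_trans taus.
    - by rewrite -ler_pdivlMr //; apply: le_trans tauL.
    - by rewrite ltn_neqAle Wb Wle.
    - by apply: leq_trans cT _; rewrite leq_mul2l matchH orbT.
    - by move=> v; rewrite inE -leqNgt.
  by move=> rho_le; have := le_trans rho_lam rho_le; rewrite ler_pM2r //; lra.
have HW e : e \in edges H -> e :&: W != set0 by apply: heavy_meets.
have HS : edges H \subset star_on q.+3 W.
  by apply/subsetP => e eH; rewrite inE (edges_uniform eH) eqxx HW.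
exists W; split=> //; split=> //.
have [v0 v0W] : exists v, v \in W by apply/card_gt0P; rewrite cW.
(* The points [v0] and 0 only serve to satisfy the membership condition. *)
have [|p [pW _]] := @exists_perm_set _ W W0 v0 (Ordinal n_gt0) (etrans cW (esym cW0)).
  by rewrite v0W inE.
exists p; split=> //.
have -> : edges (star n q.+3 beta) = star_on q.+3 [set p v | v in W] by rewrite pW.
apply: le_trans (card_symdiff_relabel_le R p HS) _.
have [lam_le lam_ge multi] := size_est W cW.
have B4 : 0 < 4 * beta%:R :> R by lra.
pose N : R := (2 * n%:R) ^+ q.+2.
have N0 : 0 < q.+3%:R * N by rewrite mulr_gt0 ?exprn_gt0 ?mulr_gt0 //; lra.
apply: (@le_trans _ _ (\sum_(v in W) 4 * beta%:R * delta * (q.+3%:R * N))).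
  apply: ler_sum => v vW; set m := _%:R.
  rewrite -ler_pdivrMr // -ler_pdivrMl // mulrC.
  (* With [eta = m / (k * N)], the deficit bound reads [1 - delta <= 1 - eta / (4 * beta)]. *)
  have mE : m = q.+3%:R * (m / (q.+3%:R * N)) * N.
    by rewrite mulrAC mulrC divfK // gt_eqF.
  have := spectral_radius_deficit b0 cW t0 t1 n_gt0 (fun v => eigen W v cW)
    lam_le lam_ge multi HS vW mE.
  by move=> /(le_trans rho_lam); rewrite ler_pM2r // lerD2l lerN2.
rewrite sumr_const cW -[leLHS]mulr_natr le_eqVlt; apply/orP; left; apply/eqP.
by rewrite /N exprMn /=; ring.
Qed.
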